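(* Let $(M,d)$ be a complete pointed metric space with base point $0$ and let $m \in \mathcal{F}(M)$. Then there exists a positive Radon measure $\mu$ on $\beta\widetilde{M}$ with $\|\mu\| = \|\Phi^*\mu\|$ (i.e. $\mu$ is an optimal representation), $\Phi^*\mu = m$, and $\mu$ concentrated on $p^{-1}(M \times M)$, i.e. $\mu(\beta\widetilde{M}\setminus p^{-1}(M\times M))=0$.
   Context: $\mathrm{Lip}_0(M)$ is the Banach space of Lipschitz $f:M\to\mathbb{R}$ with $f(0)=0$, normed by the Lipschitz constant. $\delta:M\to \mathrm{Lip}_0(M)^*$ is evaluation, $\langle f,\delta(x)\rangle=f(x)$, and the Lipschitz-free space $\mathcal{F}(M)\subset\mathrm{Lip}_0(M)^*$ is the norm-closed linear span of $\delta(M)$. Let $\widetilde{M}=\{(x,y)\in M\times M: x\neq y\}$, let $\beta\widetilde{M}$ be its Stone–Čech compactification, and identify the space $\mathcal{M}(\beta\widetilde{M})$ of signed Radon measures with $C(\beta\widetilde{M})^*$. The De Leeuw transform $\Phi:\mathrm{Lip}_0(M)\to C(\beta\widetilde{M})$ sends $f$ to the continuous extension to $\beta\widetilde{M}$ of $(x,y)\mapsto (f(x)-f(y))/d(x,y)$; $\Phi^*:\mathcal{M}(\beta\widetilde{M})\to \mathrm{Lip}_0(M)^*$ is its adjoint. Let $M^{u}$ be the uniform (Samuel) compactification of $M$ (the compactification to which every bounded uniformly continuous function on $M$ extends continuously, and in which subsets $A,B\subset M$ have disjoint closures iff $d(A,B)>0$). $p_1,p_2:\beta\widetilde{M}\to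 M^{u}$ are the continuous extensions of $(x,y)\mapsto x$ and $(x,y)\mapsto y$, and $p=(p_1,p_2):\beta\widetilde{M}\to M^{u}\times M^{u}$. Throughout, $M$ is assumed to have at least three distinct points. *)

(* Defs.v *)
From HB Require Import structures.
From mathcomp Require Import all_boot all_order all_algebra.
From mathcomp Require Import all_classical all_reals all_analysis.
Set Implicit Arguments. Unset Strict Implicit. Unset Printing Implicit Defensive.
Import Order.TTheory GRing.Theory Num.Theory.
Import numFieldNormedType.Exports.
Local Open Scope classical_set_scope.
Local Open Scope ring_scope.

Definition Mt (M : Type) := {p : M * M | p.1 <> p.2}.

Section Defs.
Context {R : realType} {M : Type}.
Variables (d : M -> M -> R) (x0 : M).

Definition is_metric :=
  (forall x y, d x y = 0 <-> x = y) /\ (forall x y, d x y = d y x) /\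
  (forall x y z, d x z <= d x y + d y z).

Definition complete_metric :=
  forall u : nat -> M,
    (forall e, 0 < e -> exists N, forall n k, (N <= n)%N -> (N <= k)%N -> d (u n) (u k) < e) ->
    exists x, forall e, 0 < e -> exists N, forall n, (N <= n)%N -> d (u n) x < e.


Definition Mt_continuous {K : topologicalType} (g : Mt M -> K) :=
  forall (z : Mt M) (V : set K), nbhs (g z) V -> exists2 delta : R, 0 < delta &
    forall z' : Mt M, d (sval z).1 (sval z').1 < delta -> d (sval z).2 (sval z').2 < delta ->
      V (g z').

Definition Mt_embedding {K : topologicalType} (g : Mt M -> K) :=
  Mt_continuous g /\
  forall (z : Mt M) (e : R), 0 < e -> exists V : set K, nbhs (g z) V /\
    forall z' : Mt M, V (g z') -> d (sval z).1 (sval z').1 < e /\ d (sval z).2 (sval z').2 < e.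

Definition is_stone_cech {K : topologicalType} (iota : Mt M -> K) :=
  [/\ hausdorff_space K, compact [set: K], Mt_embedding iota,
      closure (range iota) = [set: K] &
      forall f : Mt M -> R, (exists C : R, forall z, `|f z| <= C) -> Mt_continuous f ->
        exists F : K -> R, continuous F /\ forall z, F (iota z) = f z].

Definition M_continuous {L : topologicalType} (g : M -> L) :=
  forall (x : M) (V : set L), nbhs (g x) V -> exists2 delta : R, 0 < delta &
    forall y, d x y < delta -> V (g y).

Definition M_embedding {L : topologicalType} (g : M -> L) :=
  M_continuous g /\
  forall (x : M) (e : R), 0 < e -> exists V : set L, nbhs (g x) V /\
    forall y, V (g y) -> d x y < e.

Definition unif_continuous (f : M -> R) :=
  forall e : R, 0 < e -> exists2 delta : R, 0 < delta &
    forall x y, d x y < delta -> `|f x - f y| < e.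

Definition is_uniform_compactification {L : topologicalType} (j : M -> L) :=
  [/\ hausdorff_space L, compact [set: L], M_embedding j,
      closure (range j) = [set: L] &
      (forall f : M -> R, (exists C : R, forall x, `|f x| <= C) -> unif_continuous f ->
        exists F : L -> R, continuous F /\ forall x, F (j x) = f x) /\
      (forall F : L -> R, continuous F -> unif_continuous (F \o j))].

Definition lip0 (f : M -> R) :=
  f x0 = 0 /\ exists C : R, forall x y, `|f x - f y| <= C * d x y.

Definition lip0_ball (f : M -> R) :=
  f x0 = 0 /\ forall x y, `|f x - f y| <= d x y.

(* elements of Lip_0(M)^* are represented as functionals on M -> R;
   only their values on Lip_0(M) matter *)
Definition dual_norm (phi : (M -> R) -> R) : \bar R :=
  ereal_sup [set (`|phi f|)%:E | f in lip0_ball].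

Definition in_dual (m : (M -> R) -> R) :=
  (forall (a : R) f g, lip0 f -> lip0 g -> m (fun x => a * f x + g x) = a * m f + m g) /\
  exists C : R, forall f, lip0_ball f -> `|m f| <= C.

Definition in_free_space (m : (M -> R) -> R) :=
  in_dual m /\
  forall e : R, 0 < e -> exists s : seq (R * M),
    (dual_norm (fun f => (m f - \sum_(p <- s) p.1 * f p.2)%R) <= e%:E)%E.

Definition is_deLeeuw {K : topologicalType} (iota : Mt M -> K) (Phi : (M -> R) -> K -> R) :=
  forall f, lip0 f -> continuous (Phi f) /\
    forall z : Mt M, Phi f (iota z) = (f (sval z).1 - f (sval z).2) / d (sval z).1 (sval z).2.

End Defs.

Notation Borel K := (g_sigma_algebraType (@open K)).

Section Measures.
Context {R : realType} {K : ptopologicalType}.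


Definition radon (mu : {measure set (Borel K) -> \bar R}) :=
  (mu setT < +oo)%E /\
  forall A : set (Borel K), measurable A -> forall e : R, 0 < e ->
    exists C : set K, [/\ compact C, C `<=` A & (mu A <= mu C + e%:E)%E].

Definition PhiStar {M : Type} (Phi : (M -> R) -> K -> R) (mu : {measure set (Borel K) -> \bar R})
  : (M -> R) -> R :=
  fun f => fine (\int[mu]_k (Phi f k)%:E)%E.

End Measures.

(* Main.v *)
Require Import Defs.
From HB Require Import structures.
From mathcomp Require Import all_boot all_order all_algebra.
From mathcomp Require Import all_classical all_reals all_analysis.
From mathcomp Require Import finmap ring lra.
Set Implicit Arguments.
Unset Strict Implicit.
Unset Printing Implicit Defensive.
Import Order.TTheory GRing.Theory Num.Theory.
Import numFieldNormedType.Exports.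
Local Open Scope classical_set_scope.
Local Open Scope ring_scope.

(** Let [q(x,y) = 1/(1+d(x,y))], extended to [Q] on the Stone-Cech
    compactification [K]. Among the positive functionals on [C(K)] of norm at
    most [||m||] that represent [m], Hahn-Banach yields one whose value at [Q]
    is minimal, and Riesz representation turns it into a Radon measure [mu].
    First, [mu] does not charge [{Q = 0}] (pairs infinitely far apart): clipping a
    norming function to the bounded range that it has on a finite set carrying
    most of [m] changes [m f] little but makes its De Leeuw transform vanish
    there. Second, minimality pins both coordinates: a near-optimal solution [f]
    of the dual problem [f x - f y <= a d + d q] can be replaced, without changing
    its values on a finite set [S], by the inf-convolution of [f|S] with
    [a t + t/(1+t)], and the concavity of [t/(1+t)] then gains
    [q (1 - max_{s in S} 1/(1+d(s,y)))] in the constraint. Complementary slackness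
    makes [mu] negligible where [p_2] is far from every finite set; applying this to
    [-f] handles [p_1]. By completeness the points of [M^u] at distance zero from
    [M] are exactly those of [M]. *)

(** * The Hahn-Banach theorem on a subspace *)

Section hahn_banach.
Context {R : realType} {V : lmodType R} (D : set V).
Hypotheses (D0 : D 0) (DZD : forall a x y, D x -> D y -> D (a *: x + y)).

(** Equality in the second clause follows by applying it to [a^-1]. Later [V] is the space of all
    functions [K -> R] and [D] the continuous ones. *)
Definition sublinear_on (q : V -> R) :=
  (forall x y, D x -> D y -> q (x + y) <= q x + q y) /\
  (forall a x, 0 < a -> D x -> q (a *: x) <= a * q x).

Let DD x y : D x -> D y -> D (x + y).
Proof. by move=> Dx Dy; rewrite -[x]scale1r; exact: DZD. Qed.

Let DZ a x : D x -> D (a *: x).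
Proof. by move=> Dx; rewrite -[_ *: _]addr0; exact: DZD. Qed.

Let DN x : D x -> D (- x).
Proof. by move=> Dx; rewrite -scaleN1r; exact: DZ. Qed.

Lemma sublinear0 q : sublinear_on q -> q 0 = 0.
Proof.
move=> [qD qZ]; have := qD 0 0 D0 D0; rewrite addr0 => h1.
have h : 0 < 2^-1 :> R by rewrite invr_gt0.
have := qZ _ _ h D0; rewrite scaler0; lra.
Qed.

Lemma sublinearZ q a x : sublinear_on q -> 0 <= a -> D x -> q (a *: x) = a * q x.
Proof.
move=> sq; rewrite le_eqVlt => /predU1P[<- _|a0 Dx].
  by rewrite scale0r mul0r sublinear0.
have [qD qZ] := sq.
apply/eqP; rewrite eq_le qZ//= -ler_pdivlMl//.
have := qZ a^-1 (a *: x); rewrite invr_gt0 scalerA mulVf ?gt_eqF// scale1r.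
by apply => //; exact: DZ.
Qed.

Lemma sublinear_ge q x : sublinear_on q -> D x -> - q (- x) <= q x.
Proof.
move=> sq Dx; have [qD _] := sq; have := qD x (- x) Dx (DN Dx).
rewrite subrr sublinear0//; lra.
Qed.

(** Supplies the bound for Zorn's lemma: the pointwise infimum. It is finite because
    [q x >= - q (- x) >= - p (- x)], and subadditive because, of two near-minimisers chosen at [x]
    and at [y], the smaller one serves at both points. *)
Lemma sublinear_inf_chain (p : V -> R) (A : set (V -> R)) : A !=set0 ->
  (forall q, A q -> sublinear_on q /\ forall x, D x -> q x <= p x) ->
  (forall q r, A q -> A r -> (forall x, D x -> q x <= r x) \/
     (forall x, D x -> r x <= q x)) ->
  exists s, [/\ sublinear_on s, forall x, D x -> s x <= p x &
    forall q, A q -> forall x, D x -> s x <= q x].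
Proof.
move=> [q0 Aq0] Ap Atot; pose s x := inf [set q x | q in A].
have sinf x : D x -> has_inf [set q x | q in A].
  move=> Dx; split; first by exists (q0 x), q0.
  exists (- p (- x)) => _ [q Aq <-]; have [sq qp] := Ap _ Aq.
  by apply: le_trans (sublinear_ge sq Dx); rewrite lerN2 qp//; exact: DN.
have sq q : A q -> forall x, D x -> s x <= q x.
  by move=> Aq x Dx; apply: ge_inf; [exact: (sinf x Dx).2|exists q].
exists s; split=> //; last first.
  by move=> x Dx; apply: le_trans (sq _ Aq0 _ Dx) _; apply: (Ap _ Aq0).2.
split=> [x y Dx Dy|a x a0 Dx].
- apply/ler_addgt0Pr => e e0.
  have e20 : 0 < e / 2 by rewrite divr_gt0.
  have [_ [q Aq <-] hq] := inf_adherent e20 (sinf x Dx).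
  have [_ [r Ar <-] hr] := inf_adherent e20 (sinf y Dy).
  have [t [At tq tr]] : exists t, [/\ A t, t x <= q x & t y <= r y].
    by case: (Atot _ _ Aq Ar) => h; [exists q|exists r]; split => //; exact: h.
  have := sq _ At _ (DD Dx Dy); have := (Ap _ At).1.1 x y Dx Dy.
  rewrite -/(s x) -/(s y) in hq hr; lra.
- rewrite -ler_pdivrMl//; apply: lb_le_inf; first by exists (q0 x), q0.
  move=> _ [q Aq <-]; rewrite ler_pdivrMl//.
  by apply: le_trans (sq _ Aq _ (DZ a Dx)) _; apply: (Ap _ Aq).1.2.
Qed.

(* The perturbation that, at a minimal [q], forces [q x + q y <= q (x + y)]. *)
Lemma sublinear_perturb (q : V -> R) y : sublinear_on q -> D y ->
  exists s, [/\ sublinear_on s, forall x, D x -> s x <= q x &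
    forall x, D x -> s x <= q (x + y) - q y].
Proof.
move=> sq Dy; have [qD qZ] := sq.
(* The new functional is the infimum of [E x]: [t = 0] puts it below [q], [t = 1] gives the last
   bound, and adding the parameters gives subadditivity. *)
pose E x := [set q (x + t *: y) - t * q y | t in [set t | 0 <= t]].
have Einf x : D x -> has_inf (E x).
  move=> Dx; split; first by exists (q (x + 0 *: y) - 0 * q y), 0 => //=.
  exists (- q (- x)) => _ [t /= t0 <-].
  rewrite -(sublinearZ sq t0 Dy).
  have := qD (x + t *: y) (- x) (DD Dx (DZ t Dy)) (DN Dx).
  rewrite addrAC subrr add0r; lra.
have Ele t x : D x -> 0 <= t -> inf (E x) <= q (x + t *: y) - t * q y.
  by move=> Dx t0; apply: ge_inf; [exact: (Einf x Dx).2|exists t].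
exists (fun x => inf (E x)); split=> [|x Dx|x Dx].
- split=> [x1 x2 Dx1 Dx2|a x a0 Dx].
  + apply/ler_addgt0Pr => e e0.
    have e20 : 0 < e / 2 by rewrite divr_gt0.
    have [_ [t1 /= t10 <-] h1] := inf_adherent e20 (Einf x1 Dx1).
    have [_ [t2 /= t20 <-] h2] := inf_adherent e20 (Einf x2 Dx2).
    have := Ele (t1 + t2) _ (DD Dx1 Dx2) (addr_ge0 t10 t20).
    have := qD _ _ (DD Dx1 (DZ t1 Dy)) (DD Dx2 (DZ t2 Dy)).
    rewrite addrACA -scalerDl; lra.
  + rewrite -ler_pdivrMl//; apply: lb_le_inf; first exact: (Einf x Dx).1.
    move=> _ [t /= t0 <-]; rewrite ler_pdivrMl//.
    apply: le_trans (Ele (a * t) _ (DZ a Dx) (mulr_ge0 (ltW a0) t0)) _.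
    have := qZ _ _ a0 (DD Dx (DZ t Dy)); rewrite scalerDr scalerA; lra.
- by have := Ele 0 x Dx (lexx 0); rewrite scale0r addr0 mul0r subr0.
- by have := Ele 1 x Dx ler01; rewrite scale1r mul1r.
Qed.

(** A minimal sublinear functional [q] below [p] lies below each of its perturbations, so
    [q x + q y <= q (x + y)]; with subadditivity [q] is additive, hence linear. *)
Theorem sublinear_dominates_linear (p : V -> R) : sublinear_on p ->
  exists f : V -> R,
    (forall a x y, D x -> D y -> f (a *: x + y) = a * f x + f y) /\
    (forall x, D x -> f x <= p x).
Proof.
move=> sp.
pose T := {q : V -> R | sublinear_on q /\ forall x, D x -> q x <= p x}.
(* The order is reversed, so that a maximal element is a minimal functional. *)
pose r (s t : T) := `[< forall x, D x -> sval t x <= sval s x >].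
have Tp : sublinear_on p /\ forall x, D x -> p x <= p x by [].
have [||A Atot|[q [sq qp]] /= qmax] := @ZL_preorder T (exist _ p Tp) r.
- by move=> t; apply/asboolP.
- move=> s t u /asboolP st /asboolP tu; apply/asboolP => x Dx.
  by apply: le_trans (tu _ Dx) (st _ Dx).
- have [->|/set0P[t0 At0]] := eqVneq A set0; first by exists (exist _ p Tp).
  have [|||s [ss sp' sA]] := @sublinear_inf_chain p [set sval t | t in A].
  + by exists (sval t0), t0.
  + by move=> _ [t At <-]; exact: (svalP t).
  + move=> _ _ [t At <-] [u Au <-].
    by case: (Atot _ _ At Au) => /asboolP h; [right|left].
  + exists (exist _ s (conj ss sp')) => t At; apply/asboolP => x Dx /=.
    by apply: sA => //; exists t.
have qDl x y : D x -> D y -> q (x + y) = q x + q y.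
  move=> Dx Dy; apply/eqP; rewrite eq_le sq.1//=.
  have [s [ss sq' sy]] := sublinear_perturb sq Dy.
  have sp' x' : D x' -> s x' <= p x'.
    by move=> Dx'; apply: le_trans (sq' _ Dx') (qp _ Dx').
  have /asboolP/= h : r (exist _ q (conj sq qp)) (exist _ s (conj ss sp')).
    by apply/asboolP => x' Dx' /=; exact: sq'.
  have /asboolP/(_ _ Dx)/= := qmax (exist _ s (conj ss sp')) (asboolT h).
  have := sy x Dx; lra.
have qN x : D x -> q (- x) = - q x.
  move=> Dx; apply/eqP; rewrite -subr_eq0 opprK addrC -qDl//; last exact: DN.
  by rewrite subrr sublinear0.
exists q; split=> // a x y Dx Dy; rewrite qDl//; last exact: DZ.
congr (_ + _); have [a0|a0] := leP 0 a; first exact: sublinearZ.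
rewrite -[a]opprK scaleNr qN; last exact: DZ.
by rewrite sublinearZ// ?mulNr// oppr_ge0 ltW.
Qed.

End hahn_banach.

(** * Continuity of real-valued functions, and the open and closed sets that they define *)

Section continuous_real_functions.
Context {R : realType} {T : topologicalType}.
Implicit Types f g : T -> R.

Lemma continuous_addf f g : continuous f -> continuous g ->
  continuous (fun x => f x + g x).
Proof. by move=> cf cg x; apply: cvgD; [exact: cf|exact: cg]. Qed.

Lemma continuous_subf f g : continuous f -> continuous g ->
  continuous (fun x => f x - g x).
Proof. by move=> cf cg x; apply: cvgB; [exact: cf|exact: cg]. Qed.

Lemma continuous_mulf f g : continuous f -> continuous g ->
  continuous (fun x => f x * g x).
Proof. by move=> cf cg x; apply: cvgM; [exact: cf|exact: cg]. Qed.

Lemma continuous_cstf (a : R) : continuous (fun _ : T => a).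
Proof. by move=> x; exact: cvg_cst. Qed.

Lemma continuous_maxf f g : continuous f -> continuous g ->
  continuous (fun x => Num.max (f x) (g x)).
Proof. by move=> cf cg x; apply: continuous_max; [exact: cf|exact: cg]. Qed.

Lemma continuous_minf f g : continuous f -> continuous g ->
  continuous (fun x => Num.min (f x) (g x)).
Proof. by move=> cf cg x; apply: continuous_min; [exact: cf|exact: cg]. Qed.

Lemma continuous_bigmin n (h : 'I_n -> T -> R) a : (forall i, continuous (h i)) ->
  continuous (fun x => \big[Num.min/a]_(i < n) h i x).
Proof.
elim: n h => [|n IH] h ch.
  by under eq_fun do rewrite big_ord0; exact: continuous_cstf.
under eq_fun do rewrite big_ord_recl; apply: continuous_minf => //.
exact: (IH (fun i => h (lift ord0 i))).
Qed.

Lemma open_ltf f (a : R) : continuous f -> open [set x | f x < a].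
Proof.
move=> /continuousP cf.
by have := cf [set y | y < a] (open_lt (y := a)).
Qed.

Lemma open_gtf f (a : R) : continuous f -> open [set x | a < f x].
Proof.
move=> /continuousP cf.
by have := cf [set y | a < y] (open_gt (y := a)).
Qed.

Lemma closed_gef f (a : R) : continuous f -> closed [set x | a <= f x].
Proof.
move=> cf; rewrite -[X in closed X]setCK; apply: open_closedC.
rewrite (_ : ~` _ = [set x | f x < a]); first exact: open_ltf.
by apply/seteqP; split=> x /=; [move/negP; rewrite -ltNge|rewrite ltNge => /negP].
Qed.

End continuous_real_functions.

(** * A positive functional on [C(K)] and the content that it induces on open sets *)

Section positive_functional.
Context {R : realType} {K : ptopologicalType}.
Variable Lam : (K -> R) -> R.
Implicit Types f g : K -> R.

Definition positive_functional :=
  (forall (a : R) (f g : K -> R), continuous f -> continuous g ->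
     Lam (fun x => a * f x + g x) = a * Lam f + Lam g) /\
  (forall f : K -> R, continuous f -> (forall x, 0 <= f x) -> 0 <= Lam f).

Hypothesis LamP : positive_functional.

Lemma Lam0 : Lam (fun _ => 0) = 0.
Proof.
have c0 : continuous (fun _ : K => 0 : R) by exact: continuous_cstf.
have := LamP.1 (-1) _ _ c0 c0.
rewrite (_ : (fun _ => _) = (fun _ => 0)); first lra.
by apply/funext => x; rewrite mulr0 addr0.
Qed.

Lemma LamD f g : continuous f -> continuous g ->
  Lam (fun x => f x + g x) = Lam f + Lam g.
Proof.
move=> cf cg; rewrite -[X in _ = X + _]mul1r -LamP.1//; congr Lam.
by apply/funext => x; rewrite mul1r.
Qed.

Lemma LamZ a f : continuous f -> Lam (fun x => a * f x) = a * Lam f.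
Proof.
move=> cf; rewrite -[RHS]addr0 -Lam0 -LamP.1//; last exact: continuous_cstf.
by congr Lam; apply/funext => x; rewrite addr0.
Qed.

Lemma Lam_cst a : Lam (fun _ => a) = a * Lam (fun _ => 1).
Proof.
rewrite -LamZ; last exact: continuous_cstf.
by congr Lam; apply/funext => x; rewrite mulr1.
Qed.

Lemma LamB f g : continuous f -> continuous g ->
  Lam (fun x => f x - g x) = Lam f - Lam g.
Proof.
move=> cf cg; have -> : - Lam g = -1 * Lam g by rewrite mulN1r.
rewrite addrC -LamP.1//; congr Lam.
by apply/funext => x; rewrite mulN1r addrC.
Qed.

Lemma Lam_le f g : continuous f -> continuous g -> (forall x, f x <= g x) ->
  Lam f <= Lam g.
Proof.
move=> cf cg fg; rewrite -subr_ge0 -LamB//; apply: LamP.2.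
  exact: continuous_subf.
by move=> x; rewrite subr_ge0.
Qed.

Lemma Lam_trunc_le f e : continuous f ->
  Lam f <= Lam (fun x => Num.max (f x - e) 0) + e * Lam (fun _ => 1).
Proof.
move=> cf; have ct : continuous (fun x => Num.max (f x - e) 0).
  apply: continuous_maxf; last exact: continuous_cstf.
  by apply: continuous_subf => //; exact: continuous_cstf.
rewrite -Lam_cst -LamD//; last exact: continuous_cstf.
apply: Lam_le => // [|x].
  by apply: continuous_addf => //; exact: continuous_cstf.
by rewrite -lerBlDr le_max lexx.
Qed.

(** Vanishing off [U] stands in for compact support inside [U]. Truncation recovers the latter:
    [max (f - e) 0] lives on the closed set where [e <= f]. *)
Definition subordinate (U : set K) (f : K -> R) :=
  [/\ continuous f, forall x, 0 <= f x <= 1 & forall x, ~ U x -> f x = 0].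

Lemma subordinate_trunc U V f e : 0 < e -> subordinate U f ->
  [set x | e <= f x] `<=` V -> subordinate V (fun x => Num.max (f x - e) 0).
Proof.
move=> e0 [cf f01 fU] UV; split.
- apply: continuous_maxf; last exact: continuous_cstf.
  by apply: continuous_subf => //; exact: continuous_cstf.
- move=> x; have := f01 x; rewrite ge_max le_max lexx orbT ler01 => /andP[? ?].
  by rewrite andbT /=; lra.
- move=> x Vx; apply/max_idPr; have [/UV//|] := leP e (f x); lra.
Qed.

(** The mass that the Riesz measure will give to an open set [U]. *)
Definition open_content (U : set K) : R := sup [set Lam f | f in subordinate U].

Lemma subordinate0 U : subordinate U (fun _ => 0).
Proof. by split=> // [|x]; [exact: continuous_cstf|rewrite lexx ler01]. Qed.

Let content_sup U : has_sup [set Lam f | f in subordinate U].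
Proof.
split; first by exists (Lam (fun _ => 0)), (fun _ => 0) => //; exact: subordinate0.
exists (Lam (fun _ => 1)) => _ [f [cf f01 _] <-]; apply: Lam_le => //.
  exact: continuous_cstf.
by move=> x; have /andP[] := f01 x.
Qed.

Lemma Lam_le_content U f : subordinate U f -> Lam f <= open_content U.
Proof. by move=> Uf; apply: ub_le_sup; [exact: (content_sup U).2|exists f]. Qed.

Lemma content_le U a : (forall f, subordinate U f -> Lam f <= a) ->
  open_content U <= a.
Proof.
move=> h; apply: ge_sup; first exact: (content_sup U).1.
by move=> _ [f Uf <-]; exact: h.
Qed.

Lemma content_ge0 U : 0 <= open_content U.
Proof. by rewrite -Lam0; apply: Lam_le_content; exact: subordinate0. Qed.

Lemma content0 : open_content set0 = 0.
Proof.
apply/eqP; rewrite eq_le content_ge0 andbT; apply: content_le => f [_ _ f0].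
by rewrite -Lam0; have -> : f = fun _ => 0 by apply/funext => x; exact: f0.
Qed.

Lemma contentT : open_content setT = Lam (fun _ => 1).
Proof.
apply/eqP; rewrite eq_le; apply/andP; split.
  apply: content_le => f [cf f01 _]; apply: Lam_le => //.
    exact: continuous_cstf.
  by move=> x; have /andP[] := f01 x.
apply: Lam_le_content; split=> [|x|x /(_ I)//]; first exact: continuous_cstf.
by rewrite lexx ler01.
Qed.

Lemma content_mono U V : U `<=` V -> open_content U <= open_content V.
Proof.
move=> UV; apply: content_le => f [cf f01 f0]; apply: Lam_le_content.
by split=> // x Vx; apply: f0 => /UV.
Qed.

Let Lam1_ge0 : 0 <= Lam (fun _ => 1).
Proof. by apply: LamP.2 => //; exact: continuous_cstf. Qed.

(** By [Lam_trunc_le] a truncation loses at most [e * Lam 1], which is arbitrarily small. *)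
Lemma content_le_trunc U a : (forall f e, subordinate U f -> 0 < e ->
    Lam (fun x => Num.max (f x - e) 0) <= a) -> open_content U <= a.
Proof.
move=> h; apply: content_le => f Uf; apply/ler_addgt0Pr => e e0.
have L0 := Lam1_ge0.
have d0 : 0 < Lam (fun _ => 1) + 1 by lra.
have ed0 : 0 < e / (Lam (fun _ => 1) + 1) by rewrite divr_gt0.
apply: le_trans (Lam_trunc_le (e / (Lam (fun _ => 1) + 1)) _) _.
  by case: Uf.
apply: lerD; first exact: h.
by rewrite mulrAC ler_pdivrMr// ler_pM2l//; lra.
Qed.

Hypotheses (hK : hausdorff_space K) (cK : compact [set: K]).

(** A partition of unity: a Urysohn function [g], equal to 0 off [U] and to 1 on the part of
    [{e <= f}] outside [V], splits the truncation [h] of [f] into [h g], subordinate to [U], and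
    [h (1 - g)], subordinate to [V]. *)
Lemma contentU U V : open U -> open V ->
  open_content (U `|` V) <= open_content U + open_content V.
Proof.
move=> oU oV; apply: content_le_trunc => f e UVf e0.
have [cf f01 f0] := UVf.
have [|||g [cg gV gU g01]] := @urysohn_ext_itv K R (compact_normal hK cK)
  (~` U) ([set x | e <= f x] `\` V) 0 1 _ _ _ ltr01.
- exact: open_closedC.
- by rewrite setDE; apply: closedI; [exact: closed_gef|exact: open_closedC].
- apply/seteqP; split=> // x [Ux [/= fe Vx]].
  have : f x = 0 by apply: f0 => -[].
  by move=> fx; move: fe; rewrite fx; lra.
have {}g01 x : 0 <= g x <= 1.
  by have := g01 (g x) (ex_intro2 _ _ x I erefl); rewrite /= in_itv.
pose h := fun x => Num.max (f x - e) 0.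
have [ch h01 h0] : subordinate setT h by exact: subordinate_trunc UVf _.
rewrite -/h (_ : h = (fun x => h x * g x + h x * (1 - g x))); last first.
  by apply/funext => x; ring.
have c1g : continuous (fun x => 1 - g x).
  by apply: continuous_subf => //; exact: continuous_cstf.
rewrite LamD; [|exact: continuous_mulf|exact: continuous_mulf].
apply: lerD; apply: Lam_le_content; split.
- exact: continuous_mulf.
- move=> x; have := h01 x; have := g01 x; nra.
- by move=> x Ux; rewrite (gV (g x)) ?mulr0//; exists x.
- exact: continuous_mulf.
- move=> x; have := h01 x; have := g01 x; nra.
- move=> x Vx; have [fe|fe] := leP e (f x).
    by rewrite (gU (g x)) ?subrr ?mulr0//; exists x.
  by rewrite /h (max_idPr _) ?mul0r//; lra.
Qed.

Lemma content_bigU (U : nat -> set K) n : (forall i, open (U i)) ->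
  open_content (\bigcup_(i < n) U i) <= \sum_(i < n) open_content (U i).
Proof.
move=> oU; elim: n => [|n IH].
  by rewrite bigcup_mkord !big_ord0 content0.
rewrite bigcup_mkord !big_ord_recr /= -bigcup_mkord.
apply: le_trans (contentU _ (oU n)) _; last by rewrite lerD2r.
by apply: bigcup_open.
Qed.

(* A truncated function lives on a compact set, so finitely many [U i] cover it. *)
Lemma content_bigcup (U : nat -> set K) (a : R) : (forall i, open (U i)) ->
  (forall n, \sum_(i < n) open_content (U i) <= a) ->
  open_content (\bigcup_i U i) <= a.
Proof.
move=> oU Ua; apply: content_le_trunc => f e Uf e0.
have [cf f01 f0] := Uf.
have : compact [set x | e <= f x].
  by apply: subclosed_compact cK _ => //; exact: closed_gef.
rewrite compact_cover => /(_ nat setT U) [//||D _ DU].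
  move=> x /= fe; have [//|Ux] := pselect ((\bigcup_i U i) x).
  by move: fe; rewrite f0//; lra.
pose n := (\max_(i <- enum_fset D) i).+1.
apply: le_trans (Ua n); apply: le_trans (content_bigU n oU).
apply: Lam_le_content; apply: subordinate_trunc Uf _ => //.
move=> x /DU[i /= iD Uix]; exists i => //=.
by rewrite /n ltnS; apply: (@leq_bigmax_seq _ _ xpredT id).
Qed.

End positive_functional.

(** * Continuous functions as integrands for a finite Borel measure *)

Section borel_integral.
Context {R : realType} {K : ptopologicalType}.
Variable mu : {measure set (Borel K) -> \bar R}.
Hypotheses (cK : compact [set: K]) (muT : (mu setT < +oo)%E).
Implicit Types (f g : K -> R).

Lemma open_Borel_measurable (U : set K) : open U -> measurable (U : set (Borel K)).
Proof. exact: sub_sigma_algebra. Qed.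

Lemma closed_Borel_measurable (U : set K) :
  closed U -> measurable (U : set (Borel K)).
Proof.
move=> /closed_openC/open_Borel_measurable/measurableC.
by rewrite setCK.
Qed.

Lemma continuous_Borel_measurable f : continuous f ->
  measurable_fun setT (f : Borel K -> R).
Proof.
move=> /continuousP cf; apply: (measurability _ (measurable_realfun.RGenOpens.measurableE R)).
move=> _ [_ [a [b ->] <-]]; rewrite setTI.
by apply: open_Borel_measurable; apply/cf/interval_open.
Qed.

Lemma continuous_compact_bounded f : continuous f ->
  exists c, forall x, `|f x| <= c.
Proof.
move=> cf; have cn : {within [set: K], continuous (fun x => `|f x|)}.
  apply: continuous_subspaceT => x.
  by apply: cvg_norm; exact: cf.
have [c _ h] := compact_EVT_max (ex_intro _ (point : K) I) cK cn.
by exists `|f c| => x; apply: h; exact: mem_set.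
Qed.

Lemma finite_measure_fin_num (A : set (Borel K)) : measurable A ->
  mu A \is a fin_num.
Proof.
move=> mA; rewrite ge0_fin_numE//; apply: le_lt_trans muT.
by apply: le_measure => //; exact: mem_set.
Qed.

Lemma continuous_integrable f : continuous f ->
  mu.-integrable setT (EFin \o (f : Borel K -> R)).
Proof.
move=> cf; apply: measurable_bounded_integrable => //.
  exact: continuous_Borel_measurable.
have [c fc] := continuous_compact_bounded cf.
exists c; split; first exact: num_real.
by move=> M cM x _ /=; apply: le_trans (fc x) (ltW cM).
Qed.

Lemma indic_integrable (A : set (Borel K)) : measurable A ->
  mu.-integrable setT (EFin \o (\1_A : Borel K -> R)).
Proof.
move=> mA; apply: measurable_bounded_integrable => //.
exists 1; split=> [|M M1 x _ /=]; first exact: num_real.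
by rewrite ger0_norm// (le_trans _ (ltW M1))// indicE lern1 leq_b1.
Qed.

Lemma Rintegral_indic (A : set (Borel K)) : measurable A ->
  \int[mu]_x \1_A x = fine (mu A).
Proof. by move=> mA; rewrite /Rintegral integral_indic// setIT. Qed.

Lemma measure_le_Rintegral (A : set (Borel K)) g : measurable A ->
  continuous g -> (forall x, 0 <= g x) -> (forall x, A x -> 1 <= g x) ->
  fine (mu A) <= \int[mu]_x g x.
Proof.
move=> mA cg g0 g1; rewrite -Rintegral_indic//.
apply: le_Rintegral => //; first exact: indic_integrable.
  exact: continuous_integrable.
move=> x _; rewrite indicE; case: (pselect (A x)) => Ax.
  by rewrite mem_set//=; exact: g1.
by rewrite memNset//=; exact: g0.
Qed.

Lemma Rintegral_le_measure (A : set (Borel K)) g : measurable A ->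
  continuous g -> (forall x, g x <= 1) -> (forall x, ~ A x -> g x <= 0) ->
  \int[mu]_x g x <= fine (mu A).
Proof.
move=> mA cg g1 g0; rewrite -Rintegral_indic//.
apply: le_Rintegral => //; last 2 first.
- exact: indic_integrable.
- move=> x _; rewrite indicE; case: (pselect (A x)) => Ax.
    by rewrite mem_set//=; exact: g1.
  by rewrite memNset//=; exact: g0.
exact: continuous_integrable.
Qed.

End borel_integral.

(** * The Riesz representation theorem *)

Section riesz_measure.
Context {R : realType} {K : ptopologicalType} {Lam : (K -> R) -> R}.
Hypothesis LamP : positive_functional Lam.
Hypotheses (hK : hausdorff_space K) (cK : compact [set: K]).
Local Notation lam := (open_content Lam).

Let covers (A : set K) := [set lam U | U in [set U | open U /\ A `<=` U]].

Let covers_inf A : has_inf (covers A).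
Proof.
split; first by exists (lam setT), setT => //; split=> //; exact: openT.
by exists 0 => _ [U _ <-]; exact: content_ge0.
Qed.

Definition riesz_outer (A : set K) : \bar R := (inf (covers A))%:E.

Let riesz_outer_le A U : open U -> A `<=` U -> (riesz_outer A <= (lam U)%:E)%E.
Proof.
by move=> oU AU; rewrite lee_fin; apply: ge_inf; [exact: (covers_inf A).2|exists U].
Qed.

Let riesz_outer_lt A e : 0 < e ->
  exists U, [/\ open U, A `<=` U & ((lam U)%:E < riesz_outer A + e%:E)%E].
Proof.
move=> e0; have [_ [U [oU AU] <-] h] := inf_adherent e0 (covers_inf A).
by exists U; split.
Qed.

Let le_riesz_outer A a : (forall U, open U -> A `<=` U -> a <= lam U) ->
  (a%:E <= riesz_outer A)%E.
Proof.
move=> h; rewrite lee_fin; apply: lb_le_inf; first exact: (covers_inf A).1.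
by move=> _ [U [oU AU] <-]; exact: h.
Qed.

Lemma riesz_outer_open U : open U -> riesz_outer U = (lam U)%:E.
Proof.
move=> oU; apply/eqP; rewrite eq_le riesz_outer_le//=.
by apply: le_riesz_outer => V oV UV; exact: content_mono.
Qed.

Lemma riesz_outer0 : riesz_outer set0 = 0%E.
Proof. by rewrite riesz_outer_open ?content0//; exact: open0. Qed.

Lemma riesz_outer_ge0 A : (0 <= riesz_outer A)%E.
Proof. by apply: le_riesz_outer => U _ _; exact: content_ge0. Qed.

Lemma riesz_outer_mono : {homo riesz_outer : A B / A `<=` B >-> (A <= B)%E}.
Proof.
move=> A B AB; apply: le_riesz_outer => U oU BU.
by apply: riesz_outer_le => //; exact: subset_trans BU.
Qed.

(** Each [F n] is covered by an open set within [e / 2^(n+1)] of its outer measure, and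
    [content_bigcup] bounds the content of the union of these covers. *)
Lemma riesz_outer_sigma_subadditive : sigma_subadditive riesz_outer.
Proof.
move=> F; apply/lee_addgt0Pr => e e0.
apply: le_trans (epsilon_trick _ (fun n => riesz_outer_ge0 (F n)) (ltW e0)).
have en0 n : 0 < e / (2 ^ n.+1)%:R by rewrite divr_gt0// ltr0n expn_gt0.
have /choice[U HU] n := riesz_outer_lt (F n) (en0 n).
have oU n : open (U n) by case: (HU n).
have FU : \bigcup_n F n `<=` \bigcup_n U n.
  by move=> x [n _ Fx]; exists n => //; case: (HU n) => _ + _; exact.
apply: le_trans (riesz_outer_le (bigcup_open (fun i _ => oU i)) FU) _.
set S := (X in (_ <= X)%E).
have Sn n : ((\sum_(i < n) lam (U i))%:E <= S)%E.
  rewrite -sumEFin.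
  apply: (@le_trans _ _ (\sum_(0 <= i < n)
    (riesz_outer (F i) + (e / (2 ^ i.+1)%:R)%:E))%E).
    by rewrite big_mkord; apply: lee_sum => i _; apply: ltW; case: (HU i).
  apply: nneseries_lim_ge => i _ _.
  by rewrite adde_ge0 ?riesz_outer_ge0// lee_fin ltW.
case: S Sn => [s| |] Sn.
- by rewrite lee_fin; apply: content_bigcup => // n; rewrite -lee_fin.
- by rewrite leey.
- by have := Sn 0%N; rewrite leeNy_eq.
Qed.

HB.instance Definition _ := isOuterMeasure.Build R K riesz_outer
  riesz_outer0 riesz_outer_ge0 riesz_outer_mono riesz_outer_sigma_subadditive.

(** [X] is first enlarged to an open [V]. The truncation [h] of a function [f] subordinate to the
    part of [V] in [U] lives where [d <= f], while [g] is subordinate to the open rest [W], which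
    contains the part of [V] off [U]. The two do not overlap, so [h + g] is subordinate to [V]. *)
Lemma riesz_outer_caratheodory_open U : open U -> riesz_outer.-caratheodory U.
Proof.
move=> oU; apply: le_caratheodory_measurable => X.
apply/lee_addgt0Pr => e e0.
have [V [oV XV hV]] := riesz_outer_lt X e0.
apply: le_trans (ltW hV).
apply: (@le_trans _ _ (riesz_outer (V `&` U) + riesz_outer (V `&` ~` U))%E).
  by apply: leeD; apply: riesz_outer_mono; exact: setSI.
rewrite (riesz_outer_open (openI oV oU)) -EFinD lee_fin -lerBrDr.
apply: content_le_trunc => // f d VUf d0; rewrite lerBrDr.
have [cf f01 f0] := VUf.
pose h := fun x => Num.max (f x - d) 0.
have [ch h01 h0] : subordinate (V `&` U) h.
  apply: (subordinate_trunc d0 VUf) => x /= dx; apply: contrapT => /f0 fx.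
  by move: dx; rewrite fx; lra.
pose W := V `&` ~` [set x | d <= f x].
have oW : open W by apply: openI => //; apply: closed_openC; exact: closed_gef.
have VW : V `&` ~` U `<=` W.
  by move=> x [Vx Ux]; split=> //= dx; move: dx; rewrite f0; [lra|case].
have := riesz_outer_le oW VW; rewrite lee_fin => h1.
apply: le_trans (lerD (lexx _) h1) _; rewrite -lerBrDl.
apply: content_le => // g [cg g01 g0]; rewrite lerBrDl -LamD//.
apply: Lam_le_content => //; split; first exact: continuous_addf.
- move=> x; have := h01 x; have := g01 x; have [dx|dx] := leP d (f x).
    by rewrite -/(h x) g0; [lra|case].
  by rewrite /h (max_idPr _); lra.
- move=> x Vx; rewrite -/(h x) h0 ?g0 ?addr0//; by [case|move=> []].
Qed.

Lemma riesz_outer_caratheodory (A : set (Borel K)) :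
  measurable A -> riesz_outer.-caratheodory A.
Proof.
move=> mA; suff : <<s (@open K) >> `<=` riesz_outer.-caratheodory by exact.
apply: smallest_sub; last exact: riesz_outer_caratheodory_open.
split.
- exact: caratheodory_measurable_set0.
- by move=> B mB; rewrite setTD; exact: caratheodory_measurable_setC.
- by move=> B mB; exact: caratheodory_measurable_bigcup.
Qed.

Definition riesz_measure (A : set (Borel K)) : \bar R := riesz_outer A.

Let riesz_measure_sigma_additive : semi_sigma_additive riesz_measure.
Proof.
move=> F mF tF mUF; apply: (@caratheodory_measure_sigma_additive R K riesz_outer).
- by move=> i; exact: riesz_outer_caratheodory.
- exact: tF.
- exact: riesz_outer_caratheodory.
Qed.

HB.instance Definition _ := isMeasure.Build _ (Borel K) R riesz_measure
  riesz_outer0 riesz_outer_ge0 riesz_measure_sigma_additive.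

Lemma riesz_measure_outer_regular A e : 0 < e ->
  exists U, [/\ open U, A `<=` U & (riesz_measure U <= riesz_measure A + e%:E)%E].
Proof.
move=> /(riesz_outer_lt A)[U [oU AU lU]]; exists U; split=> //.
by rewrite /riesz_measure riesz_outer_open// ltW.
Qed.

Local Notation mu := (riesz_measure : {measure set (Borel K) -> \bar R}).

Let riesz_measure_open U : open U -> riesz_measure U = (lam U)%:E.
Proof. exact: riesz_outer_open. Qed.

Let muT : (mu setT < +oo)%E.
Proof. by rewrite /= riesz_measure_open ?ltry//; exact: openT. Qed.

Lemma riesz_measure_radon : radon mu.
Proof.
split=> // A mA e e0.
(* Inner regularity of [A] is outer regularity of its complement: the complement of [U] is closed,
   hence compact. *)
have [U [oU AU hU]] := riesz_measure_outer_regular (~` A) e0.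
have mU : measurable (U : set (Borel K)) := open_Borel_measurable oU.
have fin B := finite_measure_fin_num (A := B) muT.
have muC B : measurable B -> mu (~` B) = (mu setT - mu B)%E.
  by move=> mB; rewrite -setTD measureD// setTI.
exists (~` U); split.
- apply: subclosed_compact cK _ => //; exact: open_closedC.
- by move=> x Ux; apply: contrapT => /AU.
- have mA' := measurableC mA.
  have h : (mu U <= mu (~` A) + e%:E)%E by exact: hU.
  rewrite [X in (_ <= X + _)%E]muC// -[A in (mu A <= _)%E]setCK muC//.
  move: h; rewrite -(fineK (fin _ mU)) -(fineK (fin _ mA')) -(fineK (fin _ measurableT)).
  by rewrite -!EFinB -!EFinD !lee_fin; lra.
Qed.

Let integrable_cont (f : K -> R) : continuous f ->
  mu.-integrable setT (EFin \o (f : Borel K -> R)).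
Proof. exact: continuous_integrable. Qed.

(** [f] is cut into layers of height 1, with [g] the lowest and [h] the rest. Then
    [Lam g <= mu {f > 0}] and [mu {h > 0} <= \int g], so the errors telescope and only [mu {f > 0}]
    is left, whatever [n] is. *)
Let Lam_le_nat n (f : K -> R) : continuous f -> (forall x, 0 <= f x <= n%:R) ->
  Lam f <= \int[mu]_x f x + fine (mu [set x | 0 < f x]).
Proof.
elim: n f => [|n IH] f cf fn.
  have -> : f = fun _ => 0.
    by apply/funext => x; have := fn x; lra.
  rewrite Lam0//; apply: addr_ge0; [exact: Rintegral_ge0|exact: fine_ge0].
have c1 : continuous (fun _ : K => 1 : R) by exact: continuous_cstf.
have c0 : continuous (fun _ : K => 0 : R) by exact: continuous_cstf.
pose g x := Num.min (f x) 1; pose h x := Num.max (f x - 1) 0.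
have cg : continuous g by exact: continuous_minf.
have ch : continuous h by apply: continuous_maxf => //; exact: continuous_subf.
have fgh x : f x = g x + h x.
  rewrite /g /h; have [f1|f1] := leP (f x) 1.
    by rewrite (max_idPr _) ?addr0//; lra.
  by rewrite (max_idPl _); lra.
have g01 x : 0 <= g x <= 1.
  by rewrite /g le_min ge_min lexx orbT ler01 !andbT; case/andP: (fn x).
have hn x : 0 <= h x <= n%:R.
  rewrite /h le_max lexx orbT ge_max ler0n andbT/=.
  by have := fn x; rewrite -natr1; lra.
have Lg : Lam g <= fine (mu [set x | 0 < f x]).
  rewrite [mu _]riesz_measure_open; last exact: open_gtf.
  apply: Lam_le_content => //; split=> // x /negP; rewrite -leNgt => f0.
  by rewrite /g (min_idPl _); have := fn x; lra.
have hg : fine (mu [set x | 0 < h x]) <= \int[mu]_x g x.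
  apply: measure_le_Rintegral => //.
  - by apply: open_Borel_measurable; exact: open_gtf.
  - by move=> x; case/andP: (g01 x).
  - move=> x /=; rewrite /h lt_max ltxx orbF => h0.
    by rewrite /g (min_idPr _); lra.
have -> : f = fun x => g x + h x by apply/funext.
rewrite LamD// RintegralD//; [|exact: integrable_cont|exact: integrable_cont].
have := IH _ ch hn.
have -> : [set x | 0 < g x + h x] = [set x | 0 < f x].
  by apply/funext => x; rewrite /= fgh.
lra.
Qed.

Let Lam_le_int_ge0 (f : K -> R) : continuous f -> (forall x, 0 <= f x) ->
  Lam f <= \int[mu]_x f x.
Proof.
move=> cf f0; have [c fc] := continuous_compact_bounded cK cf.
have muT0 : 0 <= fine (mu setT) by exact: fine_ge0.
apply/ler_addgt0Pr => e e0.
(* The error of [Lam_le_nat] is at most the total mass for every multiple of [f]. Applied to [k * f]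
   and divided by [k], it falls below [e]. *)
pose k : R := (fine (mu setT) + 1) / e.
have k0 : 0 < k by rewrite divr_gt0//; lra.
have ckf : continuous (fun x => k * f x).
  by apply: continuous_mulf => //; exact: continuous_cstf.
have [n hn] : exists n, forall x, 0 <= k * f x <= n%:R.
  exists (Num.bound (k * c)) => x; rewrite mulr_ge0 ?(ltW k0)//=.
  apply: le_trans (ltW (archi_boundP _)).
    by rewrite ler_pM2l//; apply: le_trans (fc x); exact: ler_norm.
  apply: mulr_ge0; [exact: ltW|exact: le_trans (fc x)].
have := Lam_le_nat ckf hn.
rewrite LamZ// RintegralZl//; last exact: integrable_cont.
have mS : measurable ([set x | 0 < k * f x] : set (Borel K)).
  by apply: open_Borel_measurable; exact: open_gtf.
have : fine (mu [set x | 0 < k * f x]) <= fine (mu setT).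
  apply: fine_le; [exact: finite_measure_fin_num..|].
  by apply: le_measure => //; exact: mem_set.
move=> h1 h2.
have : k * Lam f <= k * (\int[mu]_x f x + e).
  have -> : k * (\int[mu]_x f x + e) = k * \int[mu]_x f x + (fine (mu setT) + 1).
    by rewrite mulrDr divfK ?gt_eqF.
  apply: le_trans h2 _; rewrite lerD2l; apply: le_trans h1 _.
  by rewrite lerDl.
by rewrite ler_pM2l.
Qed.

Lemma riesz_measureT : mu setT = (Lam (fun _ => 1))%:E.
Proof. by rewrite [LHS]riesz_measure_open ?contentT//; exact: openT. Qed.

(** Adding a constant makes [f] nonnegative, and [Lam] and the integral agree on constants. *)
Let Lam_le_int (f : K -> R) : continuous f -> Lam f <= \int[mu]_x f x.
Proof.
move=> cf; have [c fc] := continuous_compact_bounded cK cf.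
have cc : continuous (fun _ : K => c : R) by exact: continuous_cstf.
have := Lam_le_int_ge0 (continuous_addf cf cc).
rewrite LamD// RintegralD//; [|exact: integrable_cont|exact: integrable_cont].
rewrite Rintegral_cst// [mu _]riesz_measureT/= Lam_cst// lerD2r; apply => x.
by have := fc x; rewrite ler_norml; lra.
Qed.

Lemma riesz_measure_integral (f : K -> R) : continuous f ->
  \int[mu]_x f x = Lam f.
Proof.
move=> cf; apply/eqP; rewrite eq_le Lam_le_int// andbT.
have c1 : continuous (fun _ : K => -1 : R) by exact: continuous_cstf.
have := Lam_le_int (continuous_mulf c1 cf).
by rewrite LamZ// RintegralZl// ?mulN1r ?lerN2//; exact: integrable_cont.
Qed.

Theorem riesz_representation :
  exists nu : {measure set (Borel K) -> \bar R}, radon nu /\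
    forall f : K -> R, continuous f -> \int[nu]_x f x = Lam f.
Proof.
exists mu; split; [exact: riesz_measure_radon|exact: riesz_measure_integral].
Qed.

End riesz_measure.

(** * The function [1/(1+d)] and the inf-convolution with a concave gauge *)

Definition proximity {R : realType} {M : Type} (d : M -> M -> R) x y :=
  (1 + d x y)^-1.

Section metric_facts.
Context {R : realType} {M : Type} {d : M -> M -> R}.
Hypothesis hd : is_metric d.

Lemma metricxx x : d x x = 0.
Proof. exact/hd.1. Qed.

Lemma metricC x y : d x y = d y x.
Proof. exact: hd.2.1. Qed.

Lemma metric_triangle x y z : d x z <= d x y + d y z.
Proof. exact: hd.2.2. Qed.

Lemma metric_ge0 x y : 0 <= d x y.
Proof. by have := metric_triangle x y x; rewrite metricxx (metricC y x); lra. Qed.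

Lemma metric_gt0 x y : x <> y -> 0 < d x y.
Proof.
by move=> xy; rewrite lt_neqAle metric_ge0 andbT; apply/eqP => /esym/hd.1.
Qed.

Lemma Mt_d_gt0 (z : Mt M) : 0 < d (sval z).1 (sval z).2.
Proof. exact: metric_gt0 (svalP z). Qed.

Lemma proximityC x y : proximity d x y = proximity d y x.
Proof. by rewrite /proximity metricC. Qed.

Lemma proximityxx x : proximity d x x = 1.
Proof. by rewrite /proximity metricxx addr0 invr1. Qed.

Lemma proximity_gt0 x y : 0 < proximity d x y.
Proof. by rewrite invr_gt0; have := metric_ge0 x y; lra. Qed.

Lemma proximity_le1 x y : proximity d x y <= 1.
Proof. by rewrite invf_le1; have := metric_ge0 x y; lra. Qed.

Lemma proximity_mul x y : proximity d x y * (1 + d x y) = 1.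
Proof. by rewrite mulVf// gt_eqF//; have := metric_ge0 x y; lra. Qed.

(** [t -> 1/(1+t)] is 1-Lipschitz for [t >= 0]. This gives the continuity that extends [proximity]
    to [K] and, with one point fixed, to [L]. *)
Lemma proximity_dist x y x' y' :
  `|proximity d x y - proximity d x' y'| <= d x x' + d y y'.
Proof.
have h (a b : R) : 0 <= a -> 0 <= b -> `|(1 + a)^-1 - (1 + b)^-1| <= `|b - a|.
  move=> a0 b0; have -> : (1 + a)^-1 - (1 + b)^-1 = (b - a) * ((1 + a)^-1 * (1 + b)^-1).
    by field; rewrite !gt_eqF//; lra.
  rewrite normrM ler_piMr// normrM !ger0_norm ?invr_ge0; [|lra|lra].
  by rewrite mulr_ile1 ?invr_ge0 ?invf_le1//; lra.
apply: le_trans (h _ _ (metric_ge0 x y) (metric_ge0 x' y')) _.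
rewrite ler_norml; apply/andP; split.
- have := metric_triangle x x' y; have := metric_triangle x' y' y; rewrite (metricC y' y); lra.
- have := metric_triangle x' x y'; have := metric_triangle x y y'; rewrite (metricC x' x); lra.
Qed.

(** [1 - proximity] is [d/(1+d)], so [d < e/(1-e)], which is at most [2 * e] when [e <= 1/2]. *)
Lemma proximity_lt x y e : 0 < e -> e <= 2^-1 -> 1 - proximity d x y < e ->
  d x y < 2 * e.
Proof.
move=> e0 e1 h; have := proximity_mul x y; have := metric_ge0 x y.
by have := proximity_gt0 x y; nra.
Qed.

(* The McShane-type formula [min_s f s + a d(x,s) + phi (d(x,s))] with the concave
   gauge [phi t = t/(1+t)]; concavity of [phi] gains the factor
   [proximity d (S i) y] in the increment. *)
Lemma concave_extension n (S : 'I_n.+1 -> M) (f : M -> R) a : 0 <= a ->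
  (forall x y, f x - f y <= a * d x y + d x y * proximity d x y) ->
  exists g, (forall i, g (S i) = f (S i)) /\
    forall x y, exists i,
      g x - g y <= a * d x y + d x y * proximity d x y * proximity d (S i) y.
Proof.
move=> a0 hf.
pose F x (i : 'I_n.+1) := f (S i) + a * d x (S i) + d x (S i) * proximity d x (S i).
pose am x := [arg min_(i < ord0) F x i]%O.
have amP x i : F x (am x) <= F x i.
  by rewrite /am; case: arg_minP => // j _ h; exact: h.
exists (fun x => F x (am x)); split=> [i|x y].
(* At [S i] the term of index [i] equals [f (S i)], and the hypothesis on [f] says that no other
   term is smaller. *)
- apply/eqP; rewrite eq_le; apply/andP; split.
    by have := amP (S i) i; rewrite {2}/F metricxx mulr0 mul0r !addr0.
  by rewrite /F; have := hf (S i) (S (am (S i))); lra.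
(* The minimiser at [y] competes at [x], which leaves only the increments of [a t] and of the gauge
   between [d y s] and [d x s]. *)
- exists (am y); set s := S (am y).
  apply: le_trans (lerB (amP x (am y)) (lexx _)) _.
  rewrite /F -/s.
  have pu := proximity_mul y s; have pt := proximity_mul x y.
  have ps := proximity_mul x s; rewrite (proximityC s y).
  have := metric_triangle x y s; have := metric_ge0 x s; have := metric_ge0 y s; have := metric_ge0 x y.
  have := proximity_gt0 x y; have := proximity_gt0 y s; have := proximity_gt0 x s.
  move: (d x y) (d y s) (d x s) (proximity d x y) (proximity d y s) (proximity d x s)
    pu pt ps => t u w qt qu qw pu pt ps qw0 qu0 qt0 t0 u0 w0 tri.
  (* Since [t * qt = 1 - qt], and likewise for [u] and [w], the claim is [qu * qt <= qw], that is
     [1 + w <= (1 + t) * (1 + u)]: the triangle inequality suffices. *)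
  have h : w * qw - u * qu <= t * qt * qu.
    have -> : w * qw = 1 - qw by lra.
    have -> : u * qu = 1 - qu by lra.
    have -> : t * qt = 1 - qt by lra.
    have ht : t * qt = 1 - qt by lra.
    suff : qu * qt <= qw by lra.
    have h1 : 1 + w <= (1 + t) * (1 + u) by nra.
    have h2 : 0 <= qu * qt * qw by rewrite !mulr_ge0// ltW.
    have h3 : (qu * qt * qw) * (1 + w) <= (qu * qt * qw) * ((1 + t) * (1 + u)).
      exact: ler_wpM2l.
    have h4 : (qu * qt * qw) * (1 + w) = qu * qt * (qw * (1 + w)) by ring.
    have h5 : (qu * qt * qw) * ((1 + t) * (1 + u)) =
      qw * (qt * (1 + t)) * (qu * (1 + u)) by ring.
    by move: h3; rewrite h4 h5 ps pt pu !mulr1.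
  have : a * w <= a * (t + u) by exact: ler_wpM2l.
  rewrite mulrDr; lra.
Qed.

End metric_facts.

(** * The dual of [Lip_0(M)] and its norm *)

Section dual_of_lip0.
Context {R : realType} {M : Type} {d : M -> M -> R} {x0 : M}.
Hypothesis hd : is_metric d.
Implicit Types f g : M -> R.

Lemma lip0_lip f C : f x0 = 0 -> (forall x y, `|f x - f y| <= C * d x y) ->
  lip0 d x0 f.
Proof. by move=> f0 fC; split=> //; exists C. Qed.

Lemma lip0_ball_lip0 f : lip0_ball d x0 f -> lip0 d x0 f.
Proof. by move=> [f0 f1]; apply: (@lip0_lip _ 1) => // x y; rewrite mul1r. Qed.

Lemma lip0_ball0 : lip0_ball d x0 (fun _ => 0).
Proof. by split=> // x y; rewrite subrr normr0 metric_ge0. Qed.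

Lemma lip0_zero : lip0 d x0 (fun _ => 0).
Proof. exact: lip0_ball_lip0 lip0_ball0. Qed.

Lemma lip0_comb a f g : lip0 d x0 f -> lip0 d x0 g ->
  lip0 d x0 (fun x => a * f x + g x).
Proof.
move=> [f0 [C fC]] [g0 [B gB]]; apply: (@lip0_lip _ (`|a| * C + B)).
  by rewrite f0 g0; ring.
move=> x y; have -> : a * f x + g x - (a * f y + g y) =
  a * (f x - f y) + (g x - g y) by ring.
apply: le_trans (ler_normD _ _) _; rewrite mulrDl; apply: lerD => //.
by rewrite normrM -mulrA ler_wpM2l.
Qed.

Lemma lip0_scale a f : lip0 d x0 f -> lip0 d x0 (fun x => a * f x).
Proof.
move=> lf; have := lip0_comb a lf lip0_zero.
by under eq_fun do rewrite addr0.
Qed.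

Lemma lip0_add f g : lip0 d x0 f -> lip0 d x0 g -> lip0 d x0 (fun x => f x + g x).
Proof.
move=> lf lg; have := lip0_comb 1 lf lg.
by under eq_fun do rewrite mul1r.
Qed.

Lemma lip0_opp f : lip0 d x0 f -> lip0 d x0 (fun x => - f x).
Proof.
move=> lf; have := lip0_scale (-1) lf.
by under eq_fun do rewrite mulN1r.
Qed.

Variable m : (M -> R) -> R.
Hypothesis hm : in_dual d x0 m.
Let N := fine (dual_norm d x0 m).

Lemma dual0 : m (fun _ => 0) = 0.
Proof.
have := hm.1 (-1) _ _ lip0_zero lip0_zero.
by under eq_fun do rewrite mulr0 addr0; lra.
Qed.

Lemma dualD f g : lip0 d x0 f -> lip0 d x0 g ->
  m (fun x => f x + g x) = m f + m g.
Proof.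
move=> lf lg; rewrite -[m f]mul1r -hm.1//; congr m.
by apply/funext => x; rewrite mul1r.
Qed.

Lemma dualZ a f : lip0 d x0 f -> m (fun x => a * f x) = a * m f.
Proof.
move=> lf; rewrite -[RHS]addr0 -dual0 -hm.1//; last exact: lip0_zero.
by congr m; apply/funext => x; rewrite addr0.
Qed.

Lemma dualN f : lip0 d x0 f -> m (fun x => - f x) = - m f.
Proof.
move=> lf; rewrite -mulN1r -dualZ//; congr m.
by apply/funext => x; rewrite mulN1r.
Qed.

Lemma dualB f g : lip0 d x0 f -> lip0 d x0 g ->
  m (fun x => f x - g x) = m f - m g.
Proof. by move=> lf lg; rewrite dualD ?dualN//; exact: lip0_opp. Qed.

Lemma dual_norm_le C : (forall f, lip0_ball d x0 f -> `|m f| <= C) ->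
  (dual_norm d x0 m <= C%:E)%E.
Proof.
by move=> h; apply: ge_ereal_sup => _ [f bf <-]; rewrite lee_fin h.
Qed.

Lemma le_dual_norm f : lip0_ball d x0 f -> (`|m f|%:E <= dual_norm d x0 m)%E.
Proof. by move=> bf; apply: ereal_sup_ubound; exists f. Qed.

Lemma dual_normE : dual_norm d x0 m = N%:E.
Proof.
rewrite fineK// ge0_fin_numE; last first.
  by apply: le_trans (le_dual_norm lip0_ball0); rewrite lee_fin.
have [C hC] := hm.2; exact: le_lt_trans (dual_norm_le hC) (ltry _).
Qed.

Lemma lip0_ballP f : lip0_ball d x0 f -> `|m f| <= N.
Proof. by move=> bf; rewrite -lee_fin -dual_normE; exact: le_dual_norm. Qed.

(** The ball is symmetric, so the norm is approached without the absolute value. *)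
Lemma norming e : 0 < e -> exists2 f, lip0_ball d x0 f & N - e < m f.
Proof.
move=> e0; have : ~ (dual_norm d x0 m <= (N - e)%:E)%E.
  by rewrite dual_normE lee_fin; lra.
move=> h; apply: contrapT => nf; apply: h; apply: dual_norm_le => f bf.
have bNf : lip0_ball d x0 (fun x => - f x).
  case: bf => f00 f1; split=> [|x y]; first by rewrite f00 oppr0.
  by rewrite opprK addrC distrC.
rewrite ler_norml lerNl -dualN; last exact: lip0_ball_lip0.
apply/andP; split; rewrite leNgt; apply/negP => hf; apply: nf.
- by exists (fun x => - f x).
- by exists f.
Qed.

End dual_of_lip0.

(** * Rescaling to the unit ball, and approximation by finitely supported functionals *)

Section scaling_to_the_ball.
Context {R : realType} {M : Type} {d : M -> M -> R} {x0 : M}.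
Hypothesis hd : is_metric d.
Implicit Types f g : M -> R.

Lemma lip0_scale_ball f C : 0 < C -> f x0 = 0 ->
  (forall x y, `|f x - f y| <= C * d x y) ->
  lip0_ball d x0 (fun x => C^-1 * f x).
Proof.
move=> C0 f0 fC; split=> [|x y]; first by rewrite f0 mulr0.
by rewrite -mulrBr normrM ger0_norm ?invr_ge0 ?(ltW C0)// ler_pdivrMl.
Qed.

Lemma dual_le_lip m f C : in_dual d x0 m -> 0 <= C -> f x0 = 0 ->
  (forall x y, `|f x - f y| <= C * d x y) ->
  `|m f| <= fine (dual_norm d x0 m) * C.
Proof.
move=> hm C0 f0 fC; have lf := lip0_lip f0 fC.
move: C0; rewrite le_eqVlt => /predU1P[C0|C0].
  have -> : f = fun _ => 0.
    apply/funext => x; have := fC x x0.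
    by rewrite f0 subr0 -C0 mul0r normr_le0 => /eqP.
  by rewrite (dual0 hd hm) normr0 -C0 mulr0.
have := lip0_ballP hd hm (lip0_scale_ball C0 f0 fC).
rewrite (dualZ hd hm)// normrM ger0_norm ?invr_ge0 ?(ltW C0)//.
by rewrite ler_pdivrMl// mulrC.
Qed.

(** A finite combination of evaluations within [e] of [m] kills every function vanishing on its
    support, so only the error is left. Membership in the free space, beyond membership in the dual,
    enters here. The base point heads [S], which makes it nonempty and forces [f x0 = 0]. *)
Lemma free_space_finite_support m e : in_free_space d x0 m -> 0 < e ->
  exists n (S : 'I_n.+1 -> M), S ord0 = x0 /\
    forall f C, 0 < C -> (forall x y, `|f x - f y| <= C * d x y) ->
      (forall i, f (S i) = 0) -> `|m f| <= e * C.
Proof.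
move=> [hm happ] e0; have [s hs] := happ e e0.
exists (size s), (fun i => nth x0 (x0 :: map snd s) i); split=> // f C C0 fC fS.
have f0 : f x0 = 0 by exact: (fS ord0).
have bf := lip0_scale_ball C0 f0 fC.
have lf := lip0_lip f0 fC.
have : ((`|m (fun x => C^-1 * f x) - \sum_(p <- s) p.1 * (C^-1 * f p.2)|)%:E
    <= e%:E)%E.
  by apply: le_trans hs; apply: ereal_sup_ubound; exists (fun x => C^-1 * f x).
rewrite lee_fin (dualZ hd hm)// [X in _ - X](_ : _ = 0) ?subr0; last first.
  rewrite (big_nth (0, x0)) big_mkord big1// => i _.
  have -> : f (nth (0, x0) s i).2 = 0.
    by have := fS (lift ord0 i); rewrite /= (nth_map (0, x0)) add0n.
  by rewrite !mulr0.
rewrite normrM ger0_norm ?invr_ge0 ?(ltW C0)// ler_pdivrMl// mulrC//.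
Qed.

End scaling_to_the_ball.

(** Reduces inequalities between continuous functions on [K] or on [L] to the points of the
    compactified space. *)
Lemma dense_le {R : realType} {T : Type} {K : topologicalType} (iota : T -> K)
    (F G : K -> R) : closure (range iota) = [set: K] ->
  continuous F -> continuous G -> (forall z, F (iota z) <= G (iota z)) ->
  forall k, F k <= G k.
Proof.
move=> dense cF cG FG k; rewrite -subr_ge0.
have : closed [set k | 0 <= G k - F k] by apply: closed_gef; exact: continuous_subf.
move=> /closure_id E; change ([set k | 0 <= G k - F k] k); rewrite E.
have : [set: K] k by [].
by rewrite -dense; apply: closure_subset => _ [z _ <-] /=; rewrite subr_ge0.
Qed.

(** * The De Leeuw transform on the Stone-Cech compactification *)

Section deLeeuw.
Context {R : realType} {M : Type} {d : M -> M -> R} {x0 : M}.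
Hypothesis hd : is_metric d.
Context {K : ptopologicalType} {iota : Mt M -> K}.
Hypothesis hK : is_stone_cech d iota.
Context {Phi : (M -> R) -> K -> R}.
Hypothesis hPhi : is_deLeeuw d x0 iota Phi.
Implicit Types f g : M -> R.

Let dense : closure (range iota) = [set: K].
Proof. by case: hK. Qed.

Lemma deLeeuw_continuous f : lip0 d x0 f -> continuous (Phi f).
Proof. by move=> /hPhi[]. Qed.

Lemma deLeeuw_comb a f g k : lip0 d x0 f -> lip0 d x0 g ->
  Phi (fun x => a * f x + g x) k = a * Phi f k + Phi g k.
Proof.
move=> lf lg; have [cf hf] := hPhi lf; have [cg hg] := hPhi lg.
have [cfg hfg] := hPhi (lip0_comb a lf lg).
have car : continuous (fun k => a * Phi f k + Phi g k).
  apply: continuous_addf => //; apply: continuous_mulf => //.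
  exact: continuous_cstf.
have E z : Phi (fun x => a * f x + g x) (iota z) = a * Phi f (iota z) + Phi g (iota z).
  by rewrite hf hg hfg mulrA -mulrDl; congr (_ / _); ring.
apply/eqP; rewrite eq_le; apply/andP; split.
- by apply: (dense_le dense cfg car) => z; rewrite E.
- by apply: (dense_le dense car cfg) => z; rewrite E.
Qed.

Lemma deLeeuw0 k : Phi (fun _ => 0) k = 0.
Proof.
have := deLeeuw_comb (-1) k (lip0_zero hd) (lip0_zero hd).
by under [in X in X -> _]eq_fun do rewrite mulr0 addr0; lra.
Qed.

Lemma deLeeuwZ a f k : lip0 d x0 f -> Phi (fun x => a * f x) k = a * Phi f k.
Proof.
move=> lf; have := deLeeuw_comb a k lf (lip0_zero hd).
by under eq_fun do rewrite addr0; rewrite deLeeuw0 addr0.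
Qed.

Lemma deLeeuwN f k : lip0 d x0 f -> Phi (fun x => - f x) k = - Phi f k.
Proof.
move=> lf; have := deLeeuwZ (-1) k lf.
by under eq_fun do rewrite mulN1r; rewrite mulN1r.
Qed.

Lemma deLeeuwD f g k : lip0 d x0 f -> lip0 d x0 g ->
  Phi (fun x => f x + g x) k = Phi f k + Phi g k.
Proof.
move=> lf lg; have := deLeeuw_comb 1 k lf lg.
by under eq_fun do rewrite mul1r; rewrite mul1r.
Qed.

Lemma deLeeuw_le f (F : K -> R) : lip0 d x0 f -> continuous F ->
  (forall z, f (sval z).1 - f (sval z).2 <= d (sval z).1 (sval z).2 * F (iota z)) ->
  forall k, Phi f k <= F k.
Proof.
move=> lf cF h; have [cf hf] := hPhi lf; apply: (dense_le dense) => // z.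
by rewrite hf ler_pdivrMr ?Mt_d_gt0// mulrC h.
Qed.

Lemma deLeeuw_ball_le1 f k : lip0_ball d x0 f -> `|Phi f k| <= 1.
Proof.
move=> bf; have lf := lip0_ball_lip0 bf; have [f0 f1] := bf.
have h g : lip0_ball d x0 g -> Phi g k <= 1.
  move=> bg; apply: (deLeeuw_le (F := fun _ => 1)).
  - exact: lip0_ball_lip0.
  - exact: continuous_cstf.
  - by move=> z; rewrite mulr1; apply: le_trans (ler_norm _) (bg.2 _ _).
rewrite ler_norml h// andbT lerNl -deLeeuwN//; apply: h.
by split=> [|x y]; [rewrite f0 oppr0|rewrite opprK addrC distrC].
Qed.

Lemma stone_cech_proximity : exists Q : K -> R, continuous Q /\
  forall z, Q (iota z) = proximity d (sval z).1 (sval z).2.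
Proof.
case: hK => _ _ _ _; apply.
  exists 1 => z; rewrite ger0_norm ?proximity_le1//.
  by rewrite ltW// proximity_gt0.
move=> z V /nbhs_ballP[e /= e0 eV]; exists (e / 2); first by rewrite divr_gt0.
move=> z' h1 h2; apply: eV => /=; rewrite /ball /=.
by apply: le_lt_trans (proximity_dist hd _ _ _ _) _; rewrite [e]splitr ltrD.
Qed.

(** * Linear programming duality and a representing functional with minimal value at [Q] *)

Variable m : (M -> R) -> R.
Hypothesis hm : in_dual d x0 m.
Variable Q : K -> R.
Hypotheses (cQ : continuous Q)
  (hQ : forall z, Q (iota z) = proximity d (sval z).1 (sval z).2).
Let N := fine (dual_norm d x0 m).

Lemma stone_cech_proximity_ge0 k : 0 <= Q k.
Proof.
apply: (dense_le (F := fun _ => 0) dense _ cQ) => [|z].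
  exact: continuous_cstf.
by rewrite hQ ltW// proximity_gt0.
Qed.

(** The constraint is [Phi f <= a + Q], multiplied by the distance so that it also makes sense at
    [x = y]. *)
Definition dual_feasible a f := [/\ 0 <= a, lip0 d x0 f &
  forall x y, f x - f y <= a * d x y + d x y * proximity d x y].

(* By linear programming duality, the least value of [\int Q] over the
   optimal representations of [m]. *)
Definition proximity_gap := sup [set r | exists a f,
  dual_feasible a f /\ r = m f - a * N].
Local Notation V := proximity_gap.

Lemma dual_feasible_lip a f x y : dual_feasible a f ->
  `|f x - f y| <= (1 + a) * d x y.
Proof.
move=> [a0 lf h]; have h' u v : d u v * proximity d u v <= d u v.
  by rewrite ler_piMr ?metric_ge0 ?proximity_le1.
rewrite ler_norml mulrDl mul1r; apply/andP; split.
- have := h y x; have := h' y x; rewrite (metricC hd y x); lra.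
- have := h x y; have := h' x y; lra.
Qed.

Let V_sup : has_sup [set r | exists a f, dual_feasible a f /\ r = m f - a * N].
Proof.
split.
  exists (m (fun _ => 0) - 0 * N), 0, (fun _ => 0); split=> //; split=> //.
    exact: lip0_zero.
  move=> x y; rewrite subrr mul0r add0r.
  by apply: mulr_ge0; [exact: metric_ge0|apply/ltW; exact: proximity_gt0].
(* [f] is [(1 + a)]-Lipschitz, so [m f <= (1 + a) * N]. *)
exists N => _ [a [f [af ->]]]; have [a0 [f0 _] _] := af.
have a10 : 0 <= 1 + a by lra.
have := dual_le_lip hd hm a10 f0 (fun x y => dual_feasible_lip x y af).
rewrite -/N => h; have := ler_norm (m f); rewrite mulrDr mulr1 in h.
by rewrite (mulrC a); lra.
Qed.

Lemma dual_feasible_le a f : dual_feasible a f -> m f <= a * N + V.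
Proof.
move=> af; rewrite -lerBlDl; apply: ub_le_sup; first exact: V_sup.2.
by exists a, f.
Qed.

Lemma proximity_gap_approx e : 0 < e ->
  exists a f, dual_feasible a f /\ a * N + V - e < m f.
Proof.
move=> /sup_adherent/(_ V_sup)[_ [a [f [af ->]]] h]; exists a, f; split=> //.
rewrite -/V in h; lra.
Qed.

Lemma proximity_gap_ge0 : 0 <= V.
Proof.
have : dual_feasible 0 (fun _ => 0).
  split=> //; first exact: lip0_zero.
  move=> x y; rewrite subrr mul0r add0r.
  by apply: mulr_ge0; [exact: metric_ge0|apply/ltW; exact: proximity_gt0].
by move=> /dual_feasible_le; rewrite (dual0 hd hm) mul0r add0r.
Qed.

(** The homogeneous form of [dual_feasible_le], obtained by scaling the coefficient of [Q] to 1. *)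
Lemma dual_le_of_deLeeuw a b f : 0 <= a -> 0 <= b -> lip0 d x0 f ->
  (forall k, Phi f k <= a + b * Q k) -> m f <= a * N + b * V.
Proof.
move=> a0 b0 lf h.
have {}h x y : f x - f y <= a * d x y + b * (d x y * proximity d x y).
  have [->|xy] := pselect (x = y).
    by rewrite subrr metricxx// mul0r !mulr0 addr0.
  pose z : Mt M := exist (fun p : M * M => p.1 <> p.2) (x, y) xy.
  have := h (iota z); rewrite (hPhi lf).2 hQ /=.
  rewrite ler_pdivrMr ?metric_gt0//; nra.
(* [b] may be 0, so the division is by a slightly larger [c], at an extra cost of [(c - b) * V]. *)
suff H c : 0 < c -> b <= c -> m f <= a * N + c * V.
  apply/ler_addgt0Pr => e e0; have V0 := proximity_gap_ge0.
  have V1 : 0 < V + 1 by lra.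
  have eV : 0 < e / (V + 1) by rewrite divr_gt0.
  apply: le_trans (H (b + e / (V + 1)) _ _) _; [lra|lra|].
  rewrite mulrDl -!addrA !lerD2l mulrAC ler_pdivrMr//.
  by rewrite ler_pM2l//; lra.
move=> c0 bc; have : dual_feasible (a / c) (fun x => c^-1 * f x).
  split; [by rewrite divr_ge0// ltW|exact: lip0_scale|move=> x y].
  rewrite -mulrBr ler_pdivrMl// mulrDr (_ : c * (a / c * _) = a * d x y).
    apply: le_trans (h x y) _; rewrite lerD2l ler_wpM2r//.
    by apply: mulr_ge0; [exact: metric_ge0|apply/ltW; exact: proximity_gt0].
  by field; rewrite gt_eqF.
move=> /dual_feasible_le; rewrite (dualZ hd hm)// ler_pdivrMl//.
have -> // : c * (a / c * N + V) = a * N + c * V.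
by field; rewrite gt_eqF.
Qed.

(** The least price of dominating [u] when the constant 1 costs [N], [Q] costs [V] and [Phi f] costs
    [m f], the last with either sign. *)
Definition lifting_cost (u : K -> R) := inf [set r | exists a b f,
  [/\ 0 <= a, 0 <= b, lip0 d x0 f & forall k, u k <= a + b * Q k + Phi f k] /\
  r = a * N + b * V + m f].

(** The prices allow no unbounded gain: with [- c <= u], a dominating triple satisfies
    [Phi (- f) <= (a + c) + b * Q], and [dual_le_of_deLeeuw] bounds its price below by
    [- (c * N)]. *)
Let P_inf u : continuous u -> has_inf [set r | exists a b f,
  [/\ 0 <= a, 0 <= b, lip0 d x0 f & forall k, u k <= a + b * Q k + Phi f k] /\
  r = a * N + b * V + m f].
Proof.
move=> cu; have [c uc] : exists c, forall k, `|u k| <= c.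
  by apply: continuous_compact_bounded => //; case: hK.
have c0 : 0 <= c by apply: le_trans (uc point).
split.
  exists (c * N + 0 * V + m (fun _ => 0)), c, 0, (fun _ => 0); split=> //.
  split=> // [|k]; first exact: lip0_zero.
  by rewrite mul0r deLeeuw0 !addr0; apply: le_trans (ler_norm _) _.
exists (- (c * N)) => _ [a [b [f [[a0 b0 lf h] ->]]]].
have : m (fun x => - f x) <= (a + c) * N + b * V.
  apply: dual_le_of_deLeeuw => //; [lra|exact: lip0_opp|move=> k].
  rewrite deLeeuwN//; have := h k; have := uc k; rewrite ler_norml; lra.
rewrite (dualN hd hm)// mulrDl; lra.
Qed.

Let P_le u a b f : continuous u -> 0 <= a -> 0 <= b -> lip0 d x0 f ->
  (forall k, u k <= a + b * Q k + Phi f k) ->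
  lifting_cost u <= a * N + b * V + m f.
Proof.
move=> cu a0 b0 lf h; apply: ge_inf; first exact: (P_inf cu).2.
by exists a, b, f.
Qed.

Let P_sublinear : sublinear_on [set u : K -> R | continuous u] lifting_cost.
Proof.
split=> [u v /= cu cv|c u c0 /= cu].
- have cuv : continuous (u + v).
    exact: continuous_addf.
  apply/ler_addgt0Pr => e e0; have e20 : 0 < e / 2 by rewrite divr_gt0.
  have [_ [a [b [f [[a0 b0 lf h] ->]]]] hu] := inf_adherent e20 (P_inf cu).
  have [_ [a' [b' [g [[a0' b0' lg h'] ->]]]] hv] := inf_adherent e20 (P_inf cv).
  have := P_le cuv (addr_ge0 a0 a0') (addr_ge0 b0 b0') (lip0_add lf lg).
  rewrite (dualD hm)// -/(lifting_cost u) -/(lifting_cost v) in hu hv *.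
  move=> /(_ _)/le_trans; apply; last by rewrite !mulrDl; lra.
  move=> k; rewrite deLeeuwD//; have := h k; have := h' k.
  by have -> : (u + v) k = u k + v k :> R by []; rewrite !mulrDl; lra.
- have ccu : continuous (c *: u).
    apply: (@continuous_mulf _ _ (fun _ => c)) => //; exact: continuous_cstf.
  rewrite -ler_pdivrMl//; apply: lb_le_inf; first exact: (P_inf cu).1.
  move=> _ [a [b [f [[a0 b0 lf h] ->]]]]; rewrite ler_pdivrMl//.
  have := P_le ccu (mulr_ge0 (ltW c0) a0) (mulr_ge0 (ltW c0) b0) (lip0_scale hd c lf).
  rewrite (dualZ hd hm)// => /(_ _)/le_trans; apply; last by rewrite !mulrDr !mulrA.
  move=> k; rewrite deLeeuwZ// -mulrA -!mulrDr; have -> : (c *: u) k = c * u k :> R by [].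
  by rewrite ler_pM2l.
Qed.

(* Domination by [lifting_cost] encodes all four requirements at once. *)
Theorem minimal_representation : exists Lam : (K -> R) -> R,
  [/\ positive_functional Lam, forall f, lip0 d x0 f -> Lam (Phi f) = m f,
    Lam (fun _ => 1) <= N & Lam Q <= V].
Proof.
have c0 : continuous (fun _ : K => 0 : R) by exact: continuous_cstf.
have [||Lam [LamL LamP]] := @sublinear_dominates_linear R (K -> R)
  [set u : K -> R | continuous u] _ _ lifting_cost P_sublinear.
- exact: c0.
- move=> c u v /= cu cv; apply: (@continuous_addf _ _ (fun x => c * u x)) => //.
  by apply: (@continuous_mulf _ _ (fun _ => c)) => //; exact: continuous_cstf.
have LamL' (c : R) (u v : K -> R) : continuous u -> continuous v ->
  Lam (fun x => c * u x + v x) = c * Lam u + Lam v by exact: LamL.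
have LamN (u : K -> R) : continuous u -> Lam (fun x => - u x) = - Lam u.
  move=> cu; have L0 : Lam (fun _ => 0) = 0.
    have := LamL' (-1) _ _ c0 c0.
    by under eq_fun do rewrite mulr0 addr0; lra.
  have := LamL' (-1) _ _ cu c0; rewrite L0.
  by under eq_fun do rewrite mulN1r addr0; rewrite mulN1r addr0.
have cN (u : K -> R) : continuous u -> continuous (fun x : K => - u x : R).
  by move=> cu x; apply: cvgN; exact: cu.
exists Lam; split.
(* Positivity: 0 dominates [- u] at cost 0. *)
- split=> // u cu u0; rewrite -oppr_le0 -LamN//.
  apply: le_trans (LamP _ (cN _ cu)) _.
  have := P_le (cN _ cu) (lexx 0) (lexx 0) (lip0_zero hd).
  rewrite (dual0 hd hm) !mul0r !addr0; apply => k.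
  by rewrite mul0r deLeeuw0 !addr0 oppr_le0.
(* [Phi f] dominates itself at cost [m f]; the same bound for [- f] gives equality. *)
- have h f : lip0 d x0 f -> Lam (Phi f) <= m f.
    move=> lf; have cf := deLeeuw_continuous lf.
    apply: le_trans (LamP _ cf) _.
    have := P_le cf (lexx 0) (lexx 0) lf.
    by rewrite !mul0r !add0r; apply => k; rewrite mul0r !add0r.
  move=> f lf; apply/eqP; rewrite eq_le h//= -lerN2 -(dualN hd hm)//.
  rewrite -LamN; last exact: deLeeuw_continuous.
  have -> : (fun k => - Phi f k) = Phi (fun x => - f x).
    by apply/funext => k; rewrite deLeeuwN.
  exact/h/lip0_opp.
- have c1 : continuous (fun _ : K => 1 : R) by exact: continuous_cstf.
  apply: le_trans (LamP _ c1) _.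
  have := P_le c1 ler01 (lexx 0) (lip0_zero hd).
  rewrite (dual0 hd hm) mul0r mul1r !addr0; apply => k.
  by rewrite mul0r deLeeuw0 !addr0.
- apply: le_trans (LamP _ cQ) _.
  have := P_le cQ (lexx 0) ler01 (lip0_zero hd).
  rewrite (dual0 hd hm) mul0r mul1r add0r addr0; apply => k.
  by rewrite mul1r deLeeuw0 add0r addr0.
Qed.

End deLeeuw.

Arguments dual_feasible {R M} d x0 a f.
Arguments proximity_gap {R M} d x0 m.

(** * Tail estimates for a representing measure with minimal integral of [Q] *)

Section concentration.
Context {R : realType} {M : Type} {d : M -> M -> R} {x0 : M}.
Hypothesis hd : is_metric d.
Context {K : ptopologicalType} {iota : Mt M -> K}.
Hypothesis hK : is_stone_cech d iota.
Context {Phi : (M -> R) -> K -> R}.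
Hypothesis hPhi : is_deLeeuw d x0 iota Phi.
Variable m : (M -> R) -> R.
Hypothesis hm : in_free_space d x0 m.
Variable Q : K -> R.
Hypotheses (cQ : continuous Q)
  (hQ : forall z, Q (iota z) = proximity d (sval z).1 (sval z).2).
Local Notation N := (fine (dual_norm d x0 m)).
Local Notation V := (proximity_gap d x0 m).
Variable mu : {measure set (Borel K) -> \bar R}.
Hypotheses (mu_fin : (mu setT < +oo)%E) (muN : fine (mu setT) <= N)
  (muPhi : forall f, lip0 d x0 f -> \int[mu]_k Phi f k = m f)
  (muQ : \int[mu]_k Q k <= V).

Let cK : compact [set: K].
Proof. by case: hK. Qed.

Let hm1 : in_dual d x0 m := hm.1.

Let intK (f : K -> R) : continuous f ->
  mu.-integrable setT (EFin \o (f : Borel K -> R)).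
Proof. exact: continuous_integrable. Qed.

Let clip (r t : R) : R := Num.max (- r) (Num.min r t).

Let clip_dist (r s t : R) : `|clip r s - clip r t| <= `|s - t|.
Proof.
have := ler_norm (s - t); have := ler_norm (t - s); rewrite distrC /clip ler_norml.
by case: (leP r s); case: (leP r t); case: (leP (- r) r); case: (leP (- r) s);
  case: (leP (- r) t); lra.
Qed.

(** A clipped norming function [g] has [Phi g <= 1] everywhere and [Phi g <= 0] where [Q] vanishes,
    so [N - e <= m g] is at most the mass off that set. As the total mass is at most [N], at most
    [e] is left on it. *)
Lemma measure_proximity0 : mu [set k | Q k <= 0] = 0%E.
Proof.
have cZ : closed [set k | Q k <= 0].
  rewrite (_ : [set _ | _] = [set k | 0 <= - Q k]).
    by apply: closed_gef => k; apply: cvgN; exact: cQ.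
  by apply/seteqP; split=> k /=; rewrite oppr_ge0.
have mZ : measurable ([set k | Q k <= 0] : set (Borel K)).
  exact: closed_Borel_measurable.
rewrite -[LHS]fineK; last exact: finite_measure_fin_num.
congr EFin; apply/eqP; rewrite eq_le fine_ge0// andbT.
apply/ler_addgt0Pr => e e0; rewrite add0r.
have e30 : 0 < e / 3 by rewrite divr_gt0.
have [f bf mf] := norming hd hm1 e30.
have [n [S [S0 hS]]] := free_space_finite_support hd hm e30.
(* Any bound for [|f|] on [S] serves: clipping at [r] keeps the values of [f] on [S]. *)
pose r : R := \sum_(i < n.+1) `|f (S i)|.
have r0 : 0 <= r by exact: sumr_ge0.
have fr i : - r <= f (S i) <= r.
  rewrite -ler_norml /r (bigD1 i)//= lerDl; exact: sumr_ge0.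
pose g x := clip r (f x).
have gS i : g (S i) = f (S i).
  rewrite /g /clip (min_idPr _); last by case/andP: (fr i).
  by apply/max_idPr; case/andP: (fr i).
have gr x : - r <= g x <= r.
  rewrite /g /clip le_max lexx/= ge_max ge_min lexx/= andbT; lra.
have bg : lip0_ball d x0 g.
  split=> [|x y]; first by rewrite -S0 gS S0; case: bf.
  by apply: le_trans (clip_dist _ _ _) _; case: bf => _; apply.
have [lf lg] := (lip0_ball_lip0 bf, lip0_ball_lip0 bg).
(* [f - g] vanishes on [S] and is 2-Lipschitz, so clipping loses at most [2 e / 3], on top of the
   [e / 3] by which [f] misses the norm. *)
have mg : N - e <= m g.
  have h : `|m (fun x => f x - g x)| <= e / 3 * 2.
    apply: hS => // [x y|i]; last by rewrite gS subrr.
    have -> : f x - g x - (f y - g y) = (f x - f y) - (g x - g y) by ring.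
    apply: le_trans (ler_normB _ _) _; rewrite mulr2n mulrDl mul1r.
    by apply: lerD; [case: bf => _; apply|case: bg => _; apply].
  rewrite (dualB hd hm1)// ler_norml in h; lra.
have Pg k : Phi g k <= (2 * r + 1) * Q k.
  apply: (deLeeuw_le hd hK hPhi (F := fun k => (2 * r + 1) * Q k)) => //.
    by apply: continuous_mulf => //; exact: continuous_cstf.
  move=> z; rewrite hQ; have := proximity_mul hd (sval z).1 (sval z).2.
  have := gr (sval z).1; have := gr (sval z).2.
  have := bg.2 (sval z).1 (sval z).2; rewrite ler_norml.
  have := proximity_gt0 hd (sval z).1 (sval z).2.
  have := metric_ge0 hd (sval z).1 (sval z).2.
  move: (sval z).1 (sval z).2 => x y.
  move: (d x y) (proximity d x y) => t q t0 q0 h1 h2 h3 h4.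
  (* The increment of [g] is at most [t], and also at most [2 * r], which bounds its product with
     [t]. *)
  have h5 : (g x - g y) * (1 + t) <= t * (2 * r + 1) by nra.
  have -> : g x - g y = q * ((g x - g y) * (1 + t)) by rewrite mulrCA h4 mulr1.
  have -> : t * ((2 * r + 1) * q) = q * (t * (2 * r + 1)) by ring.
  by rewrite ler_pM2l.
have : \int[mu]_k Phi g k <= fine (mu (~` [set k | Q k <= 0])).
  apply: Rintegral_le_measure => //; first exact: measurableC.
  - exact: (deLeeuw_continuous hPhi).
  - by move=> k; apply: le_trans (ler_norm _) _; exact: (deLeeuw_ball_le1 hd hK hPhi).
  - move=> k /= /contrapT Qk; apply: le_trans (Pg k) _.
    by rewrite pmulr_rle0//; lra.
rewrite muPhi// -setTD measureD//= setTI fineB ?finite_measure_fin_num//.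
by move=> /le_trans/(_ (lerB muN (lexx _))); lra.
Qed.

(** Complementary slackness with an error: if [g] agrees with the near-optimal [f] on [S], then
    [m g > a * N + V - 2 * e], whereas integrating [Phi g <= a + Q - W] gives
    [m g <= a * N + V - \int W]. *)
Let extension_cost a f e : dual_feasible d x0 a f -> 0 < e ->
  a * N + V - e < m f ->
  exists n (S : 'I_n.+1 -> M), forall g (W : K -> R),
    (forall i, g (S i) = f (S i)) ->
    (forall x y, g x - g y <= (1 + a) * d x y) -> continuous W ->
    (forall z, g (sval z).1 - g (sval z).2 <=
      d (sval z).1 (sval z).2 * (a + Q (iota z) - W (iota z))) ->
    \int[mu]_k W k <= 2 * e.
Proof.
move=> af e0 mf; have [a0 lf _] := af.
have a1 : 0 < 2 * (1 + a) by lra.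
(* The tolerance is set for [f - g], which is [2 * (1 + a)]-Lipschitz, so that [m g] differs from
   [m f] by at most [e]. *)
have ea : 0 < e / (2 * (1 + a)) by rewrite divr_gt0.
have [n [S [S0 hS]]] := free_space_finite_support hd hm ea.
exists n, S => g W gS glip cW hW.
have gl x y : `|g x - g y| <= (1 + a) * d x y.
  by rewrite ler_norml glip andbT; have := glip y x; rewrite (metricC hd y x); lra.
have g0 : g x0 = 0 by rewrite -S0 gS S0; case: lf.
have lg : lip0 d x0 g := lip0_lip g0 gl.
have mg : `|m (fun x => f x - g x)| <= e.
  have -> : e = e / (2 * (1 + a)) * (2 * (1 + a)) by rewrite divfK ?gt_eqF.
  apply: hS => // [x y|i]; last by rewrite gS subrr.
  have -> : f x - g x - (f y - g y) = (f x - f y) - (g x - g y) by ring.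
  apply: le_trans (ler_normB _ _) _; rewrite -mulrA mulr_natl mulr2n.
  by apply: lerD => //; exact: (dual_feasible_lip hd _ _ af).
rewrite (dualB hd hm1)// ler_norml in mg.
have ca : continuous (fun _ : K => a : R) by exact: continuous_cstf.
have caQ := continuous_addf ca cQ.
have : \int[mu]_k Phi g k <= \int[mu]_k (a + Q k - W k).
  apply: le_Rintegral => //; [exact/intK/(deLeeuw_continuous hPhi)| |].
    exact/intK/continuous_subf.
  move=> k _; apply: (deLeeuw_le hd hK hPhi (F := fun k => a + Q k - W k)) => //.
  exact: continuous_subf.
rewrite muPhi// RintegralB//; [|exact: intK|exact: intK].
rewrite RintegralD//; [|exact: intK|exact: intK].
rewrite Rintegral_cst//.
by move=> /le_trans/(_ (lerB (lerD (ler_wpM2l a0 muN) muQ) (lexx _))); lra.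
Qed.

(** The slack [W] is the gain in [concave_extension]. The bound is asked for every [i] because the
    index producing the gain depends on the pair. *)
Lemma tail2_small e : 0 < e -> exists n (S : 'I_n.+1 -> M),
  forall W : K -> R, continuous W ->
    (forall z i, W (iota z) <= proximity d (sval z).1 (sval z).2 *
      (1 - proximity d (S i) (sval z).2)) ->
    \int[mu]_k W k <= e.
Proof.
move=> e0; have e20 : 0 < e / 2 by rewrite divr_gt0.
have [a [f [af mf]]] := proximity_gap_approx hd hm1 e20.
have [n [S hS]] := extension_cost af e20 mf; exists n, S => W cW hW.
have [a0 lf hf] := af.
have [g [gS hg]] := concave_extension hd S a0 hf.
have -> : e = 2 * (e / 2) by rewrite mulrC divfK.
apply: (hS g) => // [x y|z].
- have [i hi] := hg x y; apply: le_trans hi _; rewrite mulrDl mul1r addrC lerD2r.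
  have := proximity_le1 hd (S i) y; have := proximity_gt0 hd (S i) y.
  have := proximity_le1 hd x y; have := proximity_gt0 hd x y.
  have := metric_ge0 hd x y => t0 q0 q1 p0 p1.
  by rewrite -mulrA ler_piMr// mulr_ile1// ltW.
- have [i hi] := hg (sval z).1 (sval z).2; apply: le_trans hi _.
  rewrite -mulrA mulrC -mulrDr ler_wpM2l ?metric_ge0// hQ.
  by have := hW z i; lra.
Qed.

(** Dual feasibility is invariant under replacing [f] by [- f] and exchanging [x] and [y]. So [- f]
    is extended, and the negative of the extension gains in the first coordinate. *)
Lemma tail1_small e : 0 < e -> exists n (S : 'I_n.+1 -> M),
  forall W : K -> R, continuous W ->
    (forall z i, W (iota z) <= proximity d (sval z).1 (sval z).2 *
      (1 - proximity d (S i) (sval z).1)) ->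
    \int[mu]_k W k <= e.
Proof.
move=> e0; have e20 : 0 < e / 2 by rewrite divr_gt0.
have [a [f [af mf]]] := proximity_gap_approx hd hm1 e20.
have [n [S hS]] := extension_cost af e20 mf; exists n, S => W cW hW.
have [a0 lf hf] := af.
have hNf x y : - f x - - f y <= a * d x y + d x y * proximity d x y.
  by have := hf y x; rewrite (metricC hd y x) (proximityC hd y x); lra.
have [g [gS hg]] := concave_extension hd S a0 hNf.
have -> : e = 2 * (e / 2) by rewrite mulrC divfK.
apply: (hS (fun x => - g x)) => // [i|x y|z].
- by rewrite gS opprK.
- have -> : - g x - - g y = g y - g x by ring.
  have [i hi] := hg y x; apply: le_trans hi _; rewrite mulrDl mul1r addrC.
  rewrite (metricC hd y x) lerD2r.
  have := proximity_le1 hd (S i) x; have := proximity_gt0 hd (S i) x.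
  have := proximity_le1 hd y x; have := proximity_gt0 hd y x.
  have := metric_ge0 hd x y => t0 q0 q1 p0 p1.
  by rewrite -mulrA ler_piMr// mulr_ile1// ltW.
- have -> : - g (sval z).1 - - g (sval z).2 = g (sval z).2 - g (sval z).1 by ring.
  have [i hi] := hg (sval z).2 (sval z).1; apply: le_trans hi _.
  rewrite (metricC hd (sval z).2) (proximityC hd (sval z).2).
  rewrite -mulrA mulrC -mulrDr ler_wpM2l ?metric_ge0// hQ.
  by have := hW z i; lra.
Qed.

End concentration.

(** * The points of the uniform compactification that belong to [M] *)

Section uniform_compactification.
Context {R : realType} {M : Type} {d : M -> M -> R}.
Hypotheses (hd : is_metric d) (hcomplete : complete_metric d).
Context {L : topologicalType} {j : M -> L}.
Hypothesis hL : is_uniform_compactification d j.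

(** [d/(1+d)] is a bounded, uniformly continuous substitute for the distance to [x], so it extends
    to [L] and measures how far a point of [L] is from [x]. *)
Lemma uniform_proximity : exists Psi : M -> L -> R, forall x,
  continuous (Psi x) /\ forall y, Psi x (j y) = 1 - proximity d x y.
Proof.
case: hL => _ _ _ _ [ext _].
suff /choice[Psi hPsi] : forall x, exists F : L -> R,
  continuous F /\ forall y, F (j y) = 1 - proximity d x y by exists Psi.
move=> x; apply: ext.
  exists 1 => y; have := proximity_le1 hd x y; have := proximity_gt0 hd x y.
  by rewrite ler_norml; lra.
move=> e e0; exists e => // y z yz.
have -> : 1 - proximity d x y - (1 - proximity d x z) =
  proximity d x z - proximity d x y by ring.
apply: le_lt_trans (proximity_dist hd _ _ _ _) _.
by rewrite metricxx// add0r metricC.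
Qed.

Variable Psi : M -> L -> R.
Hypotheses (cPsi : forall x, continuous (Psi x))
  (hPsi : forall x y, Psi x (j y) = 1 - proximity d x y).

Let dense : closure (range j) = [set: L].
Proof. by case: hL. Qed.

Lemma uniform_proximity_ge0 x xi : 0 <= Psi x xi.
Proof.
apply: (dense_le (F := fun _ => 0) (G := Psi x) dense) => [||y].
- exact: continuous_cstf.
- exact: cPsi.
by rewrite hPsi subr_ge0 proximity_le1.
Qed.

Let meets_range (U : set L) xi : open U -> U xi -> exists y, U (j y).
Proof.
move=> oU Uxi; have : closure (range j) xi by rewrite dense.
by move=> /(_ U (open_nbhs_nbhs (conj oU Uxi)))[_ [[y _ <-] Uy]]; exists y.
Qed.

(* Completeness enters here: near-zeros of [Psi _ xi] form a Cauchy sequence. *)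
Lemma range_uniform_compactification xi :
  (forall e, 0 < e -> exists x, Psi x xi < e) -> range j xi.
Proof.
move=> small.
(* Starting at [n.+2] keeps the radius at most 1/2, as [proximity_lt] requires. *)
have e0 n : 0 < (n.+2%:R)^-1 :> R by rewrite invr_gt0.
have /choice[u hu] n := small _ (e0 n).
have dsmall n y : Psi (u n) (j y) < (n.+2%:R)^-1 -> d (u n) y < 2 * (n.+2%:R)^-1.
  rewrite hPsi => h; apply: proximity_lt h => //.
  by rewrite lef_pV2 ?posrE// ler_nat.
have oU n : open [set eta | Psi (u n) eta < (n.+2%:R)^-1] by exact: open_ltf.
have inv_small e : 0 < e -> exists n0, forall n, (n0 <= n)%N ->
    2 * (n.+2%:R)^-1 < e :> R.
  move=> ep; exists (Num.bound (2 / e)) => n hn.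
  rewrite -ltr_pdivlMl// mulrC invf_plt ?posrE ?divr_gt0//.
  rewrite invf_div; apply: lt_le_trans (archi_boundP _) _.
    by rewrite divr_ge0// ltW.
  by rewrite ler_nat; apply: leq_trans hn _; rewrite leqW// leqW.
have [e ep|x ux] := hcomplete (u := u).
  have e20 : 0 < e / 2 by rewrite divr_gt0.
  have [n0 hn0] := inv_small _ e20; exists n0 => n k hn hk.
  (* Two neighbourhoods of [xi] share a point [j y], and [y] is close to both [u n] and [u k]. *)
  have [||y [/= yn yk]] := @meets_range ([set eta | Psi (u n) eta < (n.+2%:R)^-1] `&`
    [set eta | Psi (u k) eta < (k.+2%:R)^-1]) xi.
  - exact: openI.
  - by split; exact: hu.
  have := lt_trans (dsmall _ _ yn) (hn0 n hn).
  have := lt_trans (dsmall _ _ yk) (hn0 k hk); have := metric_triangle hd (u n) y (u k).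
  by rewrite (metricC hd y (u k)); lra.
exists x => //; apply: contrapT => jx.
have [hausL _ [cj _] _ _] := hL.
have jx' : j x != xi by apply/eqP.
move: hausL; rewrite open_hausdorff => /(_ _ _ jx')[[A B] /=].
move=> -[/set_mem Ajx /set_mem Bxi] [oA oB /eqP AB0].
have [delta d0 hdelta] := cj x A (open_nbhs_nbhs (conj oA Ajx)).
have d20 : 0 < delta / 2 by rewrite divr_gt0.
have [n0 hn0] := inv_small _ d20; have [n1 hn1] := ux _ d20.
pose n := maxn n0 n1.
(* Some [j y] lies in [B] with [y] close to [u n], hence to the limit [x]; it then lies in [A] too,
   which is absurd. *)
have [||y [/= yn By]] := @meets_range ([set eta | Psi (u n) eta < (n.+2%:R)^-1] `&` B) xi.
- exact: openI.
- by split=> //; exact: hu.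
have Ay : A (j y).
  apply: hdelta; have := lt_trans (dsmall _ _ yn) (hn0 n (leq_maxl _ _)).
  have := hn1 n (leq_maxr _ _); have := metric_triangle hd x (u n) y.
  by rewrite (metricC hd x (u n)); lra.
by have : (A `&` B) (j y) by []; rewrite AB0.
Qed.

(** Being a countable union of closed sets, the complement has a Borel preimage, and nullity can be
    checked for one [n] at a time. *)
Lemma range_uniform_compactificationE :
  ~` range j = \bigcup_n [set xi | forall x, n.+1%:R^-1 <= Psi x xi].
Proof.
apply/seteqP; split=> xi.
- move=> nxi; apply: contrapT => h; apply: nxi.
  apply: range_uniform_compactification => e e0; apply: contrapT => small.
  apply: h; exists (Num.bound e^-1) => //= x.
  have [//|xlt] := leP _ (Psi x xi); exfalso; apply: small; exists x.
  apply: lt_trans xlt _; rewrite invf_plt ?posrE//.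
  apply: lt_le_trans (archi_boundP _) _; first by rewrite invr_ge0 ltW.
  by rewrite ler_nat leqnSn.
- move=> [n _ /= h] [y _ yxi]; have := h y; rewrite -yxi hPsi proximityxx//.
  by rewrite subrr leNgt invr_gt0 ltr0n.
Qed.

(** * Concentration of one coordinate, with [p] standing for [p1] or [p2] *)

Context {K : ptopologicalType} {iota : Mt M -> K}.
Hypothesis hK : is_stone_cech d iota.
Variable Q : K -> R.
Hypotheses (cQ : continuous Q)
  (hQ : forall z, Q (iota z) = proximity d (sval z).1 (sval z).2).
Variable mu : {measure set (Borel K) -> \bar R}.
Hypotheses (mu_fin : (mu setT < +oo)%E) (muQ0 : mu [set k | Q k <= 0] = 0%E).
Variables (p : K -> L) (pz : Mt M -> M).
Hypotheses (cp : continuous p) (pE : forall z, p (iota z) = j (pz z)).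
Hypothesis tails : forall e, 0 < e -> exists n (S : 'I_n.+1 -> M),
  forall W : K -> R, continuous W ->
    (forall z i, W (iota z) <= proximity d (sval z).1 (sval z).2 *
      (1 - proximity d (S i) (pz z))) ->
    \int[mu]_k W k <= e.

Let cK : compact [set: K].
Proof. by case: hK. Qed.

Let cPsip x : continuous (fun k => Psi x (p k)).
Proof. by move=> k; apply: continuous_comp; [exact: cp|exact: cPsi]. Qed.

Let closed_far n : closed [set k | forall x, n.+1%:R^-1 <= Psi x (p k)].
Proof.
rewrite (_ : [set _ | _] = \bigcap_(x in [set: M]) [set k | n.+1%:R^-1 <= Psi x (p k)]).
  by apply: closed_bigI => x _; exact: closed_gef.
by apply/seteqP; split=> k /= h x; [move=> _|]; exact: h.
Qed.

(** Markov's inequality: on this set the function [W], the product of [Q] with the minimum of the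
    [Psi (S i)] along [p], is at least [1/c], while [tails] makes its integral at most [e / c]. *)
Let far_null n l : mu ([set k | forall x, n.+1%:R^-1 <= Psi x (p k)] `&`
  [set k | l.+1%:R^-1 <= Q k]) = 0%E.
Proof.
set A := _ `&` _.
have mA : measurable (A : set (Borel K)).
  by apply: closed_Borel_measurable; apply: closedI => //; exact: closed_gef.
rewrite -[LHS]fineK; last exact: finite_measure_fin_num.
congr EFin; apply/eqP; rewrite eq_le fine_ge0// andbT.
apply/ler_addgt0Pr => e e0; rewrite add0r.
pose c : R := l.+1%:R * n.+1%:R.
have c0 : 0 < c by rewrite mulr_gt0.
have ec0 : 0 < e / c by rewrite divr_gt0.
have [r [S hS]] := tails ec0.
(* The default 1 of the minimum respects the lower bound, since [n.+1^-1 <= 1]. *)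
pose W k := Q k * \big[Num.min/1]_(i < r.+1) Psi (S i) (p k).
have cW : continuous W.
  by apply: continuous_mulf => //; apply: continuous_bigmin => i; exact: cPsip.
have intW : \int[mu]_k W k <= e / c.
  apply: hS => // z i; rewrite /W hQ; apply: ler_wpM2l.
    by rewrite ltW// proximity_gt0.
  by rewrite -hPsi -pE; exact: bigmin_le.
have Q0 := stone_cech_proximity_ge0 hd hK cQ hQ.
have W0 k : 0 <= W k.
  apply: mulr_ge0 => //; apply/bigmin_geP; split=> // i _.
  exact: uniform_proximity_ge0.
apply: (@le_trans _ _ (\int[mu]_k (c * W k))).
  apply: measure_le_Rintegral => //.
  - by apply: continuous_mulf => //; exact: continuous_cstf.
  - by move=> k; rewrite mulr_ge0// ltW.
  - move=> k [/= Fk Qk]; rewrite /c /W.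
    rewrite mulrACA; apply: mulr_ege1.
      by rewrite -ler_pdivrMl// mulr1.
    rewrite -ler_pdivrMl// mulr1; apply/bigmin_geP; split=> //.
    by rewrite invf_le1// ler1n.
rewrite RintegralZl//; last exact: continuous_integrable.
by rewrite -ler_pdivlMl// mulrC.
Qed.

(** Each far set is covered by the null set where [Q <= 0] and the countably many sets of
    [far_null]. *)
Lemma concentrated_on_preimage :
  measurable (~` [set k | range j (p k)] : set (Borel K)) /\
  mu (~` [set k | range j (p k)]) = 0%E.
Proof.
pose F n := [set k | forall x, n.+1%:R^-1 <= Psi x (p k)].
have -> : ~` [set k | range j (p k)] = \bigcup_n F n.
  rewrite -[LHS]/(p @^-1` (~` range j)) range_uniform_compactificationE.
  by rewrite preimage_bigcup.
have mF n : measurable (F n : set (Borel K)).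
  by apply: closed_Borel_measurable; exact: closed_far.
have mQ : measurable ([set k | Q k <= 0] : set (Borel K)).
  apply: closed_Borel_measurable.
  rewrite (_ : [set _ | _] = [set k | 0 <= - Q k]).
    by apply: closed_gef => k; apply: cvgN; exact: cQ.
  by apply/seteqP; split=> k /=; rewrite oppr_ge0.
have mUF : measurable (\bigcup_n F n : set (Borel K)) by exact: bigcupT_measurable.
split=> //.
apply: (iffLR (negligibleP mu mUF)); apply: negligible_bigcup => n.
apply: (@negligibleS _ _ _ mu ([set k | Q k <= 0] `|`
  \bigcup_l (F n `&` [set k | l.+1%:R^-1 <= Q k]))).
  move=> k Fk; have [Qk|Qk] := leP (Q k) 0; [by left|right].
  exists (Num.bound (Q k)^-1) => //; split=> //=.
  rewrite invf_ple ?posrE// ltW//; apply: lt_le_trans (archi_boundP _) _.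
    by rewrite invr_ge0 ltW.
  by rewrite ler_nat leqnSn.
apply: negligibleU; first exact/negligibleP.
apply: negligible_bigcup => l; apply/negligibleP; last exact: far_null.
apply: measurableI => //; apply: closed_Borel_measurable.
exact: closed_gef.
Qed.

End uniform_compactification.

(** * Assembly of the optimal representation from the functional and the tail estimates *)

Theorem theorem5p1 (R : realType) (M : Type) (d : M -> M -> R) (x0 : M)
  (hd : is_metric d) (hcomplete : complete_metric d)
  (h3 : exists a b c : M, [/\ a <> b, b <> c & a <> c])
  (K : ptopologicalType) (iota : Mt M -> K) (hK : is_stone_cech d iota)
  (L : topologicalType) (j : M -> L) (hL : is_uniform_compactification d j)
  (p1 p2 : K -> L) (hp1 : continuous p1) (hp2 : continuous p2)
  (hp1e : forall z : Mt M, p1 (iota z) = j (sval z).1)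
  (hp2e : forall z : Mt M, p2 (iota z) = j (sval z).2)
  (Phi : (M -> R) -> K -> R) (hPhi : is_deLeeuw d x0 iota Phi)
  (m : (M -> R) -> R) (hm : in_free_space d x0 m) :
  exists mu : {measure set (Borel K) -> \bar R},
    [/\ radon mu,
        mu setT = dual_norm d x0 (PhiStar Phi mu),
        (forall f, lip0 d x0 f -> PhiStar Phi mu f = m f) &
        mu (~` [set k | range j (p1 k) /\ range j (p2 k)]) = 0%E].
Proof.
have hm1 := hm.1; set N := fine (dual_norm d x0 m).
have [Q [cQ hQ]] := stone_cech_proximity hd hK.
have [Lam [LamP LamPhi Lam1 LamQ]] := minimal_representation hd hK hPhi hm1 cQ hQ.
have [hausK cK _ _ _] := hK.
have [mu [radon_mu mu_int]] := riesz_representation LamP hausK cK.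
have mu_fin := radon_mu.1.
have c1 : continuous (fun _ : K => 1 : R) by exact: continuous_cstf.
have muPhi f : lip0 d x0 f -> \int[mu]_k Phi f k = m f.
  by move=> lf; rewrite mu_int ?LamPhi//; exact: (deLeeuw_continuous hPhi).
have muTE : mu setT = (fine (mu setT))%:E.
  by rewrite fineK//; exact: finite_measure_fin_num.
have muT : fine (mu setT) = Lam (fun _ => 1).
  by rewrite -mu_int// Rintegral_cst// mul1r.
have muN : fine (mu setT) <= N by rewrite muT.
(* Every representing measure has at least this mass, because [|Phi f| <= 1] on the ball. *)
have Nmu : N <= fine (mu setT).
  rewrite -lee_fin -dual_normE//; apply: dual_norm_le => f bf.
  have lf := lip0_ball_lip0 bf; rewrite -muPhi//.
  have iPhi := continuous_integrable cK mu_fin (deLeeuw_continuous hPhi lf).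
  have i1 := continuous_integrable cK mu_fin c1.
  have iN1 : mu.-integrable setT (EFin \o (fun _ : Borel K => -1 : R)).
    by apply: continuous_integrable => //; exact: continuous_cstf.
  have Phi1 k := deLeeuw_ball_le1 hd hK hPhi k bf.
  rewrite ler_norml; apply/andP; split.
  - have := @le_Rintegral _ _ _ mu setT (fun _ => -1) (Phi f) measurableT iN1 iPhi.
    rewrite Rintegral_cst// mulN1r; apply => k _.
    by have := Phi1 k; rewrite ler_norml => /andP[].
  - have := @le_Rintegral _ _ _ mu setT (Phi f) (fun _ => 1) measurableT iPhi i1.
    rewrite Rintegral_cst// mul1r; apply => k _.
    by have := Phi1 k; rewrite ler_norml => /andP[].
have muQ : \int[mu]_k Q k <= proximity_gap d x0 m by rewrite mu_int.
have [Psi /all_and2[cPsi hPsi]] := uniform_proximity hd hL.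
have muQ0 := measure_proximity0 hd hK hPhi hm cQ hQ mu_fin muN muPhi.
have [m1 n1] := concentrated_on_preimage hd hcomplete hL cPsi hPsi hK cQ hQ
  mu_fin muQ0 hp1 hp1e
  (tail1_small hd hK hPhi hm cQ hQ mu_fin muN muPhi muQ).
have [m2 n2] := concentrated_on_preimage hd hcomplete hL cPsi hPsi hK cQ hQ
  mu_fin muQ0 hp2 hp2e
  (tail2_small hd hK hPhi hm cQ hQ mu_fin muN muPhi muQ).
exists mu; split=> //.
(* The two functionals agree on the ball, over which both suprema are taken. *)
- have -> : dual_norm d x0 (PhiStar Phi mu) = dual_norm d x0 m.
    rewrite /dual_norm; congr ereal_sup; apply/seteqP.
    split=> _ [f bf <-]; exists f => //; congr (`|_|)%:E.
      by rewrite -muPhi//; exact: lip0_ball_lip0.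
    by rewrite -muPhi//; exact: lip0_ball_lip0.
  by rewrite dual_normE// muTE; congr EFin; apply/eqP; rewrite eq_le muN Nmu.
- rewrite (_ : ~` _ = ~` [set k | range j (p1 k)] `|` ~` [set k | range j (p2 k)]).
    apply: (iffLR (negligibleP mu (measurableU _ _ m1 m2))).
    by apply: negligibleU; apply/negligibleP.
  by rewrite -setCI.
Qed.
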